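(* Let $n\ge 2$ be an integer, let $p_1,\dots,p_n$ be distinct primes, and let $G_n$ be the group defined in the context. Then the Cantor-Bendixson rank of $\mathbb X(G_n)$ is $n$.
   Context: Orders. An order on a group $G$ is a strict total order $<$ on $G$ that is bi-invariant: $a<b$ implies $ca<cb$ and $ac<bc$ for all $a,b,c\in G$. Orders correspond bijectively to positive cones, i.e. subsets $P\subseteq G$ with $G=P\sqcup P^{-1}\sqcup\{1\}$, $P\cdot P\subseteq P$, $gPg^{-1}\subseteq P$ for all $g\in G$, via $P=\{g: 1<g\}$. The space of orders $\mathbb X(G)$ is the set of all positive cones of $G$, with the subspace topology from $2^G$ (product topology). Cantor-Bendixson rank. For a topological space $Y$, the derivative $Y'$ is the set of non-isolated points of $Y$; put $Y^{(0)}=Y$, $Y^{(\alpha+1)}=(Y^{(\alpha)})'$, and $Y^{(\alpha)}=\bigcap_{\gamma<\alpha}Y^{(\gamma)}$ for limit ordinals $\alpha$. The Cantor-Bendixson rank of $Y$ is the least ordinal $\alpha$ with $Y^{(\alpha)}=Y^{(\alpha+1)}$. The group $G_n$. Let $A=\{m/2^k: m,k\in\mathbb Z\}$ be the additive group of dyadic rationals and $X=\{x\in A: 0\le x<1\}$. For $1\le i\le n$, $z\in\mathbb Z$, $x\in X$ let $H^i_{z,x}$ be a copy of $(\mathbb Q,+)$, written multiplicatively; $h^{i,r}_{z,x}$ denotes its element corresponding to $r\in\mathbb Q$ (so $h^{i,r}_{z,x}h^{i,s}_{z,x}=h^{i,r+s}_{z,x}$). Let $H^i_z=\bigoplus_{x\in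 X}H^i_{z,x}$, $H^i=\bigoplus_{z\in\mathbb Z}H^i_z$, and $P_n=H^1\times\cdots\times H^n$. Write elements of $A$ multiplicatively as $\lambda^\alpha$ ($\alpha\in A$), and elements of $\mathbb Z$ as $\zeta^\beta$ ($\beta\in\mathbb Z$). Let $M_n=P_n\rtimes A$, with conjugation action determined by $\lambda^{-\alpha}h^{i,r}_{z,x}\lambda^{\alpha}=h^{i,\,rp_i^m}_{z,\,x+\alpha 2^z-m}$, where $m\in\mathbb Z$ is the integer with $m\le x+\alpha2^z<m+1$. Let $G_n=M_n\rtimes\mathbb Z$, with conjugation action determined by $\zeta^{-\beta}h^{i,r}_{z,x}\zeta^\beta=h^{i,r}_{z+\beta,x}$ and $\zeta^{-\beta}\lambda^\alpha\zeta^\beta=\lambda^{\alpha/2^\beta}$. *)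

(* Defs.v *)
From HB Require Import structures.
From mathcomp Require Import all_boot all_order all_algebra.
From mathcomp Require Import ring.
From mathcomp Require Import boolp classical_sets functions topology.
From mathcomp Require Import freeg.

Set Implicit Arguments.
Unset Strict Implicit.
Unset Printing Implicit Defensive.

Import Order.TTheory GRing.Theory Num.Theory.
Local Open Scope classical_set_scope.
Local Open Scope ring_scope.

Section SpaceOfOrders.
Context (G : groupType).
Local Open Scope group_scope.

Record positive_cone (P : set G) : Prop := PositiveCone {
  cone_cover : forall g, [\/ P g, P g^-1 | g = 1];
  cone_not_inv : forall g, P g -> ~ P g^-1;
  cone_not1 : ~ P 1;
  cone_mul : forall g h, P g -> P h -> P (g * h);
  cone_conj : forall g h, P h -> P (g * h * g^-1)
}.

Definition space_of_orders : set {ptws G -> bool} :=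
  [set P | positive_cone [set g | P g]].

End SpaceOfOrders.

Arguments space_of_orders : clear implicits.

(* [ord_sup b] is the least ordinal strictly above all the [b j]; in particular
   any ordinal is the [ord_sup] of the family of all smaller ordinals.  Distinct
   terms may denote the same ordinal: equality of ordinals is [ord_le] in both
   directions. *)
Inductive Ord : Type := ord_sup (J : Type) (b : J -> Ord).

Fixpoint ord_le (a b : Ord) : Prop :=
  match a, b with
  | @ord_sup J f, @ord_sup K g => forall j : J, exists k : K, ord_le (f j) (g k)
  end.

Definition ord_lt (a b : Ord) : Prop :=
  match b with @ord_sup J g => exists j : J, ord_le a (g j) end.

Definition ord_zero : Ord := ord_sup (fun e : Empty_set => match e with end).
Definition ord_succ (a : Ord) : Ord := ord_sup (fun _ : unit => a).
Definition ord_of_nat (n : nat) : Ord := iter n ord_succ ord_zero.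

Definition ord_limit (a : Ord) : Prop :=
  ord_lt ord_zero a /\ forall b, ord_lt b a -> ord_lt (ord_succ b) a.

Lemma ord_le_refl a : ord_le a a.
Proof. by elim: a => I f IH /= i; exists i. Qed.

Lemma ord_le_trans a b c : ord_le a b -> ord_le b c -> ord_le a c.
Proof.
elim: a b c => I f IH [J g] [K h] /= ab bc i.
have [j fg] := ab i; have [k gh] := bc j.
by exists k; apply: IH gh.
Qed.

Lemma ord_lt_succ a : ord_lt a (ord_succ a).
Proof. by exists tt; exact: ord_le_refl. Qed.

Lemma ord_le0 a : ord_le ord_zero a.
Proof. by case: a => J g []. Qed.

Lemma ord_of_nat_mono p q : (p <= q)%N -> ord_le (ord_of_nat p) (ord_of_nat q).
Proof.
elim: p q => [|p IH] [|q] //= pq; try exact: ord_le0.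
by move=> _; exists tt; exact: IH.
Qed.

Lemma ord_of_nat_cases n b :
  ord_le (ord_of_nat n) b \/
  exists2 m, (m < n)%N & ord_le b (ord_of_nat m) /\ ord_le (ord_of_nat m) b.
Proof.
elim: n b => [|n IH] b; first by left; exact: ord_le0.
have [nb|[m mn bm]] := IH b; last by right; exists m => //; exact: ltnW.
have [[c cb nc]|noc] := pselect (exists2 c, ord_lt c b & ord_le (ord_of_nat n) c).
  case: b {nb} cb => J g /= [j cj]; left => _; exists j.
  exact: ord_le_trans cj.
right; exists n => //; split => //; case: b nb noc => J g nb noc.
have gj j : exists2 m, (m < n)%N & ord_le (g j) (ord_of_nat m).
  have [ng|[m mn [gm _]]] := IH (g j); last by exists m.
  by case: noc; exists (g j) => //; exists j; exact: ord_le_refl.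
case: n {IH nb noc} gj => [|n] gj /= j; first by have [] := gj j.
exists tt; have [m mn gm] := gj j; apply: ord_le_trans gm _.
exact: ord_of_nat_mono.
Qed.

Section CantorBendixson.
Context (T : topologicalType).
Implicit Types (Y E F : set T) (a b : Ord).

(* [isolated E] is the set of points of [E] that are isolated in the subspace
   topology of [E], so subsets of [T] stand for subspaces of [T]. *)
Definition derived E : set T := E `\` isolated E.

(* A single clause covers the zero, successor and limit cases; they are
   recovered in [CB_derived0], [CB_derivedS] and [CB_derived_limit]. *)
Fixpoint CB_derived Y (a : Ord) : set T :=
  match a with
  | @ord_sup J b =>
      Y `&` \bigcap_(j in [set: J]) derived (CB_derived Y (b j))
  end.

Definition CB_stable Y a : Prop :=
  CB_derived Y a = CB_derived Y (ord_succ a).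

Definition CB_rank_is Y a : Prop :=
  CB_stable Y a /\ forall b, CB_stable Y b -> ord_le a b.

Lemma derivedS E F : E `<=` F -> derived E `<=` derived F.
Proof.
move=> EF x [Ex nE]; split; first exact: EF.
case=> _ [V Vx VF]; apply: nE; split; first exact/mem_set.
exists V => //; apply/seteqP; split=> y.
  by case=> Vy /EF Fy; rewrite -VF.
by move=> ->; split => //; exact: nbhs_singleton.
Qed.

Lemma CB_derived_sub Y a : CB_derived Y a `<=` Y.
Proof. by case: a => I b x []. Qed.

Lemma CB_derived0 Y : CB_derived Y ord_zero = Y.
Proof. by apply/seteqP; split=> [x []|x Yx] //; split => // -[]. Qed.

Lemma CB_derivedS Y a : CB_derived Y (ord_succ a) = derived (CB_derived Y a).
Proof.
apply/seteqP; split=> x /=; first by case=> _ /(_ tt I).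
move=> dx; split => [|_ _] //.
by case: dx => /CB_derived_sub.
Qed.

Lemma CB_derived_le Y a b : ord_le a b -> CB_derived Y b `<=` CB_derived Y a.
Proof.
elim: a b => I f IH [J g] /= ab x [Yx dx]; split => // i _.
have [j fg] := ab i; apply: (derivedS (IH i _ fg)); exact: dx.
Qed.

Lemma CB_derived_limit Y a : ord_limit a ->
  CB_derived Y a = \bigcap_(b in [set b | ord_lt b a]) CB_derived Y b.
Proof.
case: a => J g [lt0 ltS]; apply/seteqP; split=> x.
  move=> [Yx dx] b [j bj]; apply: (CB_derived_le bj).
  by have [] := dx j Logic.I.
move=> dx; split=> [|j _].
  by rewrite -(CB_derived0 Y); exact: dx.
rewrite -CB_derivedS; apply: (dx (ord_succ (g j))).
by apply: ltS; exists j; exact: ord_le_refl.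
Qed.

Lemma CB_rank_natP Y n : CB_rank_is Y (ord_of_nat n) <->
  iter n derived Y = iter n.+1 derived Y /\
  forall m, (m < n)%N -> iter m derived Y <> iter m.+1 derived Y.
Proof.
have E m : CB_derived Y (ord_of_nat m) = iter m derived Y.
  by elim: m => [|m IH]; rewrite ?CB_derived0 // CB_derivedS IH.
have St m : CB_stable Y (ord_of_nat m) <->
    iter m derived Y = iter m.+1 derived Y.
  by rewrite /CB_stable CB_derivedS E.
have nlt m q : (m < q)%N -> ~ ord_le (ord_of_nat q) (ord_of_nat m).
  elim: q m => [|q IH] [|m] //= mq H; first by have [] := H tt.
  by have [_ /IH] := H tt; apply.
split=> -[st mn]; split; try exact/St.
  by move=> m lmn /St /mn; exact: nlt.
move=> b sb; have [//|[m lmn [bm mb]]] := ord_of_nat_cases n b.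
have Eb : CB_derived Y b = CB_derived Y (ord_of_nat m).
  by apply/seteqP; split; exact: CB_derived_le.
case: (mn m lmn); apply/St.
by rewrite /CB_stable CB_derivedS -Eb -CB_derivedS.
Qed.

End CantorBendixson.

Definition dyadic : pred rat :=
  fun q => `[< exists m k : int, q = m%:~R / 2 ^ k >].

Lemma dyadicP (q : rat) :
  reflect (exists m k : int, q = m%:~R / 2 ^ k) (q \in dyadic).
Proof. exact: asboolP. Qed.

Lemma dyadicPn (q : rat) :
  q \in dyadic -> exists (m : int) (k : nat), q = m%:~R / 2 ^+ k.
Proof.
case/dyadicP => m [[k|k] ->]; first by exists m, k.
exists (m * 2 ^+ k.+1), 0%N.
by rewrite /exprz invrK expr0 divr1 rmorphM rmorphXn.
Qed.

Fact dyadic_zmod_closed : zmod_closed dyadic.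
Proof.
split; first by apply/dyadicP; exists 0, 0; rewrite mul0r.
move=> x y /dyadicPn [m [k ->]] /dyadicPn [m' [k' ->]].
apply/dyadicP; exists (m * 2 ^+ k' - m' * 2 ^+ k), (k + k')%N.
rewrite rmorphB !rmorphM !rmorphXn /= -exprnP exprD.
by field; rewrite !expf_neq0.
Qed.

HB.instance Definition _ := GRing.isZmodClosed.Build rat dyadic dyadic_zmod_closed.

Record Dyadic : Type := MkDyadic { dyadic_val :> rat; _ : dyadic_val \in dyadic }.
HB.instance Definition _ := [isSub for dyadic_val].
HB.instance Definition _ := [Choice of Dyadic by <:].
HB.instance Definition _ := [SubChoice_isSubZmodule of Dyadic by <:].

Lemma dyadic_mul2z_subproof (a : Dyadic) (z : int) : (a : rat) * 2 ^ z \in dyadic.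
Proof.
case: a => a /=/dyadicP [m [k ->]]; apply/dyadicP; exists m, (k - z).
by rewrite !invr_expz opprB -mulrA -expfzDr // [- k + z]addrC.
Qed.

Definition mul2z (a : Dyadic) (z : int) : Dyadic := MkDyadic (dyadic_mul2z_subproof a z).

Definition unit_interval : pred Dyadic := fun x => 0 <= (x : rat) < 1.
Record X : Type := MkX { X_val :> Dyadic; _ : X_val \in unit_interval }.
HB.instance Definition _ := [isSub for X_val].
HB.instance Definition _ := [Choice of X by <:].

Definition dyadic_floor (a : Dyadic) : int := Num.floor (a : rat).

Lemma int_dyadic_subproof (m : int) : (m%:~R : rat) \in dyadic.
Proof. by apply/dyadicP; exists m, 0; rewrite expr0z divr1. Qed.
Definition int_dyadic (m : int) : Dyadic := MkDyadic (int_dyadic_subproof m).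

Lemma dyadic_frac_subproof (a : Dyadic) :
  a - int_dyadic (dyadic_floor a) \in unit_interval.
Proof.
rewrite unfold_in /unit_interval /= /dyadic_floor.
rewrite subr_ge0 ltrBlDr addrC.
by have /andP[-> /=] := floor_itv (dyadic_val a); rewrite intrD.
Qed.

Definition dyadic_frac (a : Dyadic) : X := MkX (dyadic_frac_subproof a).

(* [Hgrp] is the common model of the groups H^i, i.e. the direct sum of the
   copies H^i_{z,x} of Q over all (z, x), and [Pgrp n] is the product of [n]
   copies of [Hgrp].  Both are written additively. *)
Definition Hgrp : lmodType rat := {freeg (int * X) / rat}.
Definition Pgrp (n : nat) : lmodType rat := {ffun 'I_n -> Hgrp}.

(* h^{i,r}_{z,x} *)
Definition h_elt (n : nat) (i : 'I_n) (r : rat) (z : int) (x : X) : Pgrp n :=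
  [ffun j => if j == i then (<< r *g (z, x) >> : Hgrp) else 0].

(* The conjugation actions of A and Z, extended by linearity from the
   generators: [lambda_act p a h] and [zeta_act b h] stand for
   lambda^{-a} h lambda^a and zeta^{-b} h zeta^b. *)
Definition lambda_act (n : nat) (p : 'I_n -> nat) (a : Dyadic) (h : Pgrp n) :
    Pgrp n :=
  [ffun i => fglift (fun zx : int * X =>
     let y : Dyadic := (zx.2 : Dyadic) + mul2z a zx.1 in
     (<< (p i)%:R ^ dyadic_floor y *g (zx.1, dyadic_frac y) >> : Hgrp)) (h i)].

Definition zeta_act (n : nat) (b : int) (h : Pgrp n) : Pgrp n :=
  [ffun i => fglift (fun zx : int * X =>
     (<< 1 *g (zx.1 + b, zx.2) >> : Hgrp)) (h i)].

HB.instance Definition _ (R : nzRingType) (K : choiceType) (M : lmodType R)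
    (f : K -> M) :=
  GRing.isZmodMorphism.Build {freeg K / R} M (fglift f) (lift_is_additive f).

Section LinearExtension.
Context (K : choiceType).
Implicit Types (f : K -> {freeg K / rat}) (D : {freeg K / rat}).

Lemma freegZU (k c : rat) (x : K) :
  k *: (<< c *g x >> : {freeg K / rat}) = << k * c *g x >>.
Proof. by apply/eqP/freeg_eqP => y; rewrite coeffZ !coeffU mulrA. Qed.

Lemma fglift_additive_ext (F G : {additive {freeg K / rat} -> {freeg K / rat}}) :
  (forall k x, F << k *g x >> = G << k *g x >>) -> F =1 G.
Proof. by move=> FG D; rewrite -(freeg_sumE D) !raddf_sum; apply: eq_bigr. Qed.

Lemma fglift_id f : (forall x, f x = << 1 *g x >>) -> forall D, fglift f D = D.
Proof.
move=> fE D; rewrite -[LHS]/(fglift f D).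
apply: (@fglift_additive_ext (fglift f) idfun) => k x.
by rewrite [LHS]liftU fE freegZU mulr1.
Qed.

Lemma fglift_comp (c d e : K -> rat) (u v w : K -> K) :
  (forall x, w x = u (v x)) -> (forall x, e x = d x * c (v x)) ->
  forall D, fglift (fun x => << c x *g u x >> : {freeg K / rat})
    (fglift (fun x => << d x *g v x >> : {freeg K / rat}) D) =
  fglift (fun x => << e x *g w x >> : {freeg K / rat}) D.
Proof.
move=> wE eE D.
apply: (@fglift_additive_ext (fglift _ \o fglift _) (fglift _)) => k x.
by rewrite /= !liftU !freegZU liftU freegZU wE eE mulrA.
Qed.

End LinearExtension.

Lemma mul2zD a b z : mul2z (a + b) z = mul2z a z + mul2z b z.
Proof. by apply: val_inj; rewrite /= mulrDl. Qed.
Lemma mul2zA a z w : mul2z (mul2z a z) w = mul2z a (z + w).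
Proof. by apply: val_inj; rewrite /= -mulrA expfzDr. Qed.
Lemma mul2z0 a : mul2z a 0 = a.
Proof. by apply: val_inj; rewrite /= expr0z mulr1. Qed.
Lemma mul20z z : mul2z 0 z = 0.
Proof. by apply: val_inj; rewrite /= mul0r. Qed.
Lemma mul2zN a z : mul2z (- a) z = - mul2z a z.
Proof. by apply: val_inj; rewrite /= mulNr. Qed.

Lemma dyadic_floorD (a : Dyadic) (m : int) :
  dyadic_floor (a - int_dyadic m) = dyadic_floor a - m.
Proof. by rewrite /dyadic_floor /= -intrN floorDrz ?intr_int // intrKfloor. Qed.

Lemma dyadic_fracD (a : Dyadic) (m : int) :
  dyadic_frac (a - int_dyadic m) = dyadic_frac a.
Proof.
apply/val_inj/val_inj => /=; rewrite dyadic_floorD intrB; ring.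
Qed.

Lemma dyadic_floorX (x : X) : dyadic_floor x = 0.
Proof.
apply: floor_def; rewrite add0r.
by have := valP x; rewrite unfold_in.
Qed.

Lemma dyadic_fracX (x : X) : dyadic_frac x = x.
Proof. by apply/val_inj/val_inj; rewrite /= dyadic_floorX subr0. Qed.

Section Actions.
Context (n : nat) (p : 'I_n -> nat).
Implicit Types (h : Pgrp n) (a : Dyadic) (b : int).

Lemma lambda_actD a : {morph lambda_act p a : h g / h + g}.
Proof. by move=> h g; apply/ffunP => i; rewrite !ffunE raddfD. Qed.
Lemma zeta_actD b : {morph @zeta_act n b : h g / h + g}.
Proof. by move=> h g; apply/ffunP => i; rewrite !ffunE raddfD. Qed.
Lemma lambda_act0 a : lambda_act p a 0 = 0.
Proof. by apply/ffunP => i; rewrite !ffunE raddf0. Qed.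
Lemma zeta_act0 b : zeta_act b (0 : Pgrp n) = 0.
Proof. by apply/ffunP => i; rewrite !ffunE raddf0. Qed.
Lemma lambda_actN a h : lambda_act p a (- h) = - lambda_act p a h.
Proof. by apply/ffunP => i; rewrite !ffunE raddfN. Qed.
Lemma zeta_actN b h : zeta_act b (- h) = - zeta_act b h.
Proof. by apply/ffunP => i; rewrite !ffunE raddfN. Qed.

Lemma lambda_act_id h : lambda_act p 0 h = h.
Proof.
apply/ffunP => i; rewrite ffunE; apply: fglift_id => -[z x] /=.
by rewrite mul20z addr0 dyadic_floorX dyadic_fracX expr0z.
Qed.

Lemma zeta_act_id h : zeta_act 0 h = h.
Proof. by apply/ffunP => i; rewrite ffunE; apply: fglift_id => -[z x]; rewrite addr0. Qed.

Lemma zeta_act_comp b b' h : zeta_act b (zeta_act b' h) = zeta_act (b' + b) h.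
Proof.
apply/ffunP => i; rewrite !ffunE.
by apply: fglift_comp => -[z x] /=; rewrite ?addrA ?mulr1.
Qed.

Lemma zeta_lambda_act b a h :
  zeta_act b (lambda_act p a h) = lambda_act p (mul2z a (- b)) (zeta_act b h).
Proof.
apply/ffunP => i; rewrite !ffunE.
set e := fun zx : int * X => (p i)%:R ^ dyadic_floor ((zx.2 : Dyadic) + mul2z a zx.1) : rat.
pose w (zx : int * X) := (zx.1 + b, dyadic_frac ((zx.2 : Dyadic) + mul2z a zx.1)).
have E (z : int) : - b + (z + b) = z by ring.
rewrite (@fglift_comp _ _ _ e _ _ w) //; last by move=> zx; rewrite mulr1.
rewrite (@fglift_comp _ _ _ e _ _ w) // => -[z x] /=; first by rewrite mul2zA E.
by rewrite mul2zA E mul1r.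
Qed.

Hypothesis p_prime : forall i, prime (p i).

Lemma lambda_act_comp a a' h :
  lambda_act p a (lambda_act p a' h) = lambda_act p (a' + a) h.
Proof.
apply/ffunP => i; rewrite !ffunE.
have E (x : X) z : (dyadic_frac ((x : Dyadic) + mul2z a' z) : Dyadic) + mul2z a z =
    (x : Dyadic) + mul2z (a' + a) z -
    int_dyadic (dyadic_floor ((x : Dyadic) + mul2z a' z)).
  by rewrite /= mul2zD addrAC -!addrA.
apply: fglift_comp => -[z x] /=; rewrite E ?dyadic_fracD //.
rewrite dyadic_floorD -expfzDr; first by congr (_ ^ _); ring.
by rewrite pnatr_eq0 -lt0n prime_gt0.
Qed.

End Actions.

(* [Gn p_prime] is G_n = (P_n ><| A) ><| Z; the record [MkGn b a h] stands for
   the element zeta^b lambda^a h. *)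
Record Gn (n : nat) (p : 'I_n -> nat) (p_prime : forall i, prime (p i)) : Type :=
  MkGn { zeta_part : int; lambda_part : Dyadic; h_part : Pgrp n }.

Section GnGroup.
Context (n : nat) (p : 'I_n -> nat) (p_prime : forall i, prime (p i)).
Local Notation G := (Gn p_prime).
Implicit Types u v w : G.

Definition Gn_tuple u : int * Dyadic * Pgrp n :=
  (zeta_part u, lambda_part u, h_part u).
Definition tuple_Gn (t : int * Dyadic * Pgrp n) : G := MkGn p_prime t.1.1 t.1.2 t.2.
Lemma Gn_tupleK : cancel Gn_tuple tuple_Gn. Proof. by case. Qed.
HB.instance Definition _ := Choice.copy G (can_type Gn_tupleK).

Definition Gn_one : G := MkGn p_prime 0 0 0.

(* zeta^b lambda^a h zeta^b' lambda^a' h'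
     = zeta^(b + b') lambda^(a / 2^b' + a') (h ^ (zeta^b' lambda^a')) h' *)
Definition Gn_mul u v : G :=
  MkGn p_prime (zeta_part u + zeta_part v)
    (mul2z (lambda_part u) (- zeta_part v) + lambda_part v)
    (lambda_act p (lambda_part v) (zeta_act (zeta_part v) (h_part u)) + h_part v).

Definition Gn_inv u : G :=
  MkGn p_prime (- zeta_part u) (- mul2z (lambda_part u) (zeta_part u))
    (- lambda_act p (- mul2z (lambda_part u) (zeta_part u))
         (zeta_act (- zeta_part u) (h_part u))).

Lemma Gn_mulA : associative Gn_mul.
Proof.
case=> [b a h] [b' a' h'] [b2 a2 h2]; rewrite /Gn_mul /=; congr MkGn.
- by rewrite addrA.
- by rewrite mul2zD mul2zA addrA opprD.
- rewrite zeta_actD lambda_actD addrA zeta_lambda_act zeta_act_comp.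
  by rewrite (lambda_act_comp p_prime).
Qed.

Lemma Gn_mul1 : left_id Gn_one Gn_mul.
Proof.
case=> b a h; rewrite /Gn_mul /= mul20z !add0r zeta_act0 lambda_act0 add0r //.
Qed.

Lemma Gn_1mul : right_id Gn_one Gn_mul.
Proof.
case=> b a h; rewrite /Gn_mul /= oppr0 mul2z0 !addr0 zeta_act_id lambda_act_id //.
Qed.

Lemma Gn_mulV : left_inverse Gn_one Gn_inv Gn_mul.
Proof.
case=> b a h; rewrite /Gn_mul /Gn_one /=; congr MkGn.
- by rewrite addNr.
- by rewrite mul2zN mul2zA subrr mul2z0 addNr.
- rewrite zeta_actN lambda_actN zeta_lambda_act (lambda_act_comp p_prime).
  rewrite zeta_act_comp mul2zN mul2zA subrr mul2z0 !addNr.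
  by rewrite zeta_act_id lambda_act_id addNr.
Qed.

Lemma Gn_Vmul : right_inverse Gn_one Gn_inv Gn_mul.
Proof.
case=> b a h; rewrite /Gn_mul /Gn_one /=; congr MkGn.
- by rewrite addrN.
- by rewrite opprK addrN.
- by rewrite addrN.
Qed.

HB.instance Definition _ :=
  isGroup.Build G Gn_mulA Gn_mul1 Gn_1mul Gn_mulV Gn_Vmul.

Definition zeta (b : int) : G := MkGn p_prime b 0 0.
Definition lambda (a : Dyadic) : G := MkGn p_prime 0 a 0.
Definition of_P (h : Pgrp n) : G := MkGn p_prime 0 0 h.

Lemma zetaD b b' : zeta (b + b') = (zeta b * zeta b')%g.
Proof.
by rewrite /zeta; congr MkGn; rewrite /= ?mul20z ?zeta_act0 ?lambda_act0 ?addr0.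
Qed.

Lemma lambdaD a a' : lambda (a + a') = (lambda a * lambda a')%g.
Proof.
rewrite /lambda; congr MkGn; rewrite /= ?zeta_act0 ?lambda_act0 ?addr0 //.
by rewrite oppr0 mul2z0.
Qed.

Lemma of_PD h h' : of_P (h + h') = (of_P h * of_P h')%g.
Proof.
rewrite /of_P; congr MkGn; rewrite /= ?mul20z ?addr0 //.
by rewrite zeta_act_id lambda_act_id.
Qed.

Lemma Gn_normal_form b a h : MkGn p_prime b a h = (zeta b * lambda a * of_P h)%g.
Proof.
congr MkGn; rewrite /= ?mul20z ?add0r ?addr0 ?oppr0 ?mul2z0 //.
by rewrite ?zeta_act0 ?lambda_act0 ?add0r ?zeta_act0 ?lambda_act0 ?add0r.
Qed.

Lemma conj_zeta_lambda b a : (lambda a ^ zeta b)%g = lambda (mul2z a (- b)).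
Proof.
apply: (@mulgI _ (zeta b)); rewrite -conjgC.
by congr MkGn; rewrite /= ?mul20z ?zeta_act0 ?lambda_act0 ?addr0 ?add0r.
Qed.

Lemma conj_zeta_P b h : (of_P h ^ zeta b)%g = of_P (zeta_act b h).
Proof.
apply: (@mulgI _ (zeta b)); rewrite -conjgC.
congr MkGn; rewrite /= ?mul20z ?addr0 ?add0r //.
by rewrite lambda_act_id zeta_act0 lambda_act0 add0r.
Qed.

Lemma conj_lambda_P a h : (of_P h ^ lambda a)%g = of_P (lambda_act p a h).
Proof.
apply: (@mulgI _ (lambda a)); rewrite -conjgC.
congr MkGn; rewrite /= ?mul20z ?addr0 ?add0r ?oppr0 ?mul2z0 //.
by rewrite zeta_act_id zeta_act0 lambda_act0 add0r.
Qed.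

Lemma conj_zeta_h b i r z x :
  (of_P (h_elt i r z x) ^ zeta b)%g = of_P (h_elt i r (z + b) x).
Proof.
rewrite conj_zeta_P; congr of_P; apply/ffunP => j; rewrite !ffunE.
case: eqP => _; last by rewrite raddf0.
by rewrite liftU freegZU mulr1.
Qed.

Lemma conj_lambda_h (a : Dyadic) i r z (x x' : X) (m : int) :
  (x : rat) + (a : rat) * 2 ^ z = (x' : rat) + m%:~R ->
  (of_P (h_elt i r z x) ^ lambda a)%g = of_P (h_elt i (r * (p i)%:R ^ m) z x').
Proof.
move=> xE; rewrite conj_lambda_P; congr of_P; apply/ffunP => j; rewrite !ffunE.
case: eqP => [->|_]; last by rewrite raddf0.
rewrite liftU freegZU /=.
have -> : (x : Dyadic) + mul2z a z = (x' : Dyadic) - int_dyadic (- m).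
  by apply: val_inj; rewrite /= xE intrN opprK.
by rewrite dyadic_floorD dyadic_fracD dyadic_floorX dyadic_fracX opprK add0r.
Qed.

End GnGroup.

(* Main.v *)
Require Import Defs.
From mathcomp Require Import all_boot all_order all_algebra.
From mathcomp Require Import boolp classical_sets functions topology.
From mathcomp Require Import ring lra zify.
From mathcomp Require Import algC freeg.
From HB Require Import structures.

Set Implicit Arguments.
Unset Strict Implicit.
Unset Printing Implicit Defensive.

Import Order.TTheory GRing.Theory Num.Theory Defs.
Local Open Scope ring_scope.

(** The rank is computed by describing all orders of [G_n] explicitly.

    Call the copies [H^i_z] of the direct sum over [X] the blocks of [P_n]; they
    are indexed by pairs [(i, z)].  Sending [h^{i,r}_{z,x}] to the real number
    [r * p_i ^ x] identifies each block with the subfield of the reals generated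
    by the [2^k]-th roots of [p_i], because the powers [p_i ^ x] with
    [0 <= x < 1] are linearly independent over the rationals ([rpow_free]); under
    this identification [lambda^a] multiplies the block [(i, z)] by [p_i ^ (a 2^z)]
    ([bval_lambda]), and [zeta] shifts [z].

    Fix an order.
    - On one block it is the order of the reals or its reverse: if [x * 2^-z] is
      the power of [lambda] carrying the generator at [0] to the one at [x], a
      wrong comparison with a rational multiple can be iterated until this power
      acts as an integer power of [p_i], which gives a contradiction ([pos_cmp]).
    - Of two distinct blocks one is infinitesimal with respect to the other: some
      power of [lambda] multiplies them by different integers, as the primes are
      distinct, and iterating it scales the ratio of their elements at will
      ([cone_rel_dominates]).
    - A positive element [lambda^a] exceeds all of [P_n], and a positive power of
      [zeta] exceeds all of [P_n ><| A], since conjugation by a positive element [g]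
      or its inverse cannot raise an element [h >= g] to a power at least [2]
      ([cone_lt_conj]).
    Hence an order is the same thing as signs for [zeta], [lambda] and each index
    [i], and a shift-invariant total order on the set of blocks ([cone_lexE],
    [lexcone_cone]).

    In a shift-invariant order each chain [(i, z)], [z] in the integers, is
    increasing or decreasing, and two chains are either interleaved with a
    definite offset or entirely on one side of each other.  Interleaving is an
    equivalence relation on the indices.  Finitely many comparisons express the
    signs, the directions, the offsets and the position of unlinked chains at
    [0]; an order which shares them is either the same order or has strictly
    fewer interleaving classes ([block_order_rigid]).  So the [k]-th derivative
    only contains orders with more than [k] classes, and the [n]-th is empty.
    Conversely, if the chains all increase and the first ones are interleaved, then
    pushing the last interleaved chain to infinity gives in the limit an order with
    one more class ([cvg_shifted]); so the [k]-th derivative is nonempty for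
    [k < n]. *)

(** * Linear independence of fractional powers of a prime *)

(** The minimal polynomial [g] of [y] divides [X^N - p], so all its roots have
    [N]-th power [p], and the [N]-th power of the rational number [`|g(0)|] is
    [p ^ deg g].  Comparing the exponents of [p] shows that [N] divides [deg g]. *)
Lemma small_poly_radical_eq0 (p N : nat) (y : algC) (f : {poly rat}) :
  prime p -> (0 < N)%N -> y ^+ N = p%:R -> (size f <= N)%N ->
  root (map_poly ratr f) y -> f = 0.
Proof.
move=> pp N0 yN sf; have [g [gE gm] ->] := minCpolyP y => gf.
apply/eqP; apply: contraT => f0.
have sgf := dvdp_leq f0 gf.
have gX : g %| 'X^N - p%:R%:P.
  have [g' [g'E _] rg'] := minCpolyP y.
  have <- : g' = g.
    apply: (@map_inj_poly _ _ (ratr : rat -> algC)); rewrite -?gE -?g'E ?rmorph0 //.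
    exact: fmorph_inj.
  by rewrite -rg' rmorphB /= map_polyXn map_polyC /= ratr_nat /root !hornerE yN subrr.
have [r rE] := closed_field_poly_normal (minCpoly y).
rewrite (monicP (minCpoly_monic y)) scale1r in rE.
have sr : size r = (size g).-1.
  by rewrite -(size_map_poly (ratr : {rmorphism rat -> algC})) -gE rE size_prod_XsubC.
have rN z : z \in r -> z ^+ N = p%:R.
  move=> zr; apply/eqP; rewrite -subr_eq0.
  have : root (map_poly ratr g) z by rewrite -gE rE root_prod_XsubC.
  have /dvdpP [k kE] := gX => rg.
  have : root (map_poly ratr ('X^N - p%:R%:P) : {poly algC}) z.
    by rewrite kE rmorphM rootM rg orbT.
  by rewrite rmorphB /= map_polyXn map_polyC /= ratr_nat /root !hornerE.
(* Up to sign, the constant coefficient of [g] is the product of its roots. *)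
have g0E : (ratr g.[0] : algC) ^+ N = (-1) ^+ (size r * N) * p%:R ^+ size r.
  have -> : ratr g.[0] = (map_poly ratr g).[0] :> algC.
    by rewrite -(rmorph0 (ratr : {rmorphism rat -> algC})) horner_map.
  rewrite -gE rE horner_prod -prodrXl.
  rewrite (eq_big_seq (fun=> (-1) ^+ N * p%:R)) => [|z zr]; last first.
    by rewrite !hornerE [LHS]exprNn (rN z).
  rewrite big_split /= !big_const_seq count_predT !iter_mulr_1.
  by rewrite -exprM mulnC.
have : `|g.[0]| ^+ N = p%:R ^+ size r.
  apply: (fmorph_inj (ratr : {rmorphism rat -> algC})).
  rewrite rmorphXn /= ratr_norm -normrX g0E normrM normrX normrN1 expr1n mul1r.
  by rewrite rmorphXn /= ratr_nat ger0_norm // exprn_ge0 // ler0n.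
set s := `|g.[0]|.
have s0 : s != 0 -> s ^+ N = p%:R ^+ size r -> (N %| size r)%N.
  move=> s0 sE.
  have : (`|numq s| ^ N = p ^ size r * `|denq s| ^ N)%N.
    apply/eqP; rewrite -(eqr_nat rat) natrM !natrX -sE -exprMn; apply/eqP; congr (_ ^+ _).
    rewrite -{2}[s]divq_num_den !natr_absz !intr_norm ger0_norm;
      last by rewrite ler0z numq_ge0 /s.
    by rewrite (ger0_norm (x := (denq s)%:~R)) ?ler0z ?denq_ge0 // divfK // intr_eq0 denq_neq0.
  move/(congr1 (logn p)); rewrite lognM ?expn_gt0 ?absz_gt0 ?denq_neq0 ?(prime_gt0 pp) //.
  rewrite pfactorK // !lognX => E.
  by rewrite -(dvdn_addl (n := (N * logn p `|denq s|)%N)) ?dvdn_mulr // -E dvdn_mulr.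
move=> sE; have sn0 : s != 0.
  apply: contra_eq_neq sE => ->; rewrite expr0n eqn0Ngt N0 eq_sym /= expf_neq0 //.
  by rewrite pnatr_eq0 -lt0n prime_gt0.
have := s0 sn0 sE; have := size_minCpoly y; rewrite gE size_map_poly sr.
move=> g1 /dvdn_leq Ng; have {}Ng : (N <= (size g).-1)%N.
  by apply: Ng; move: g1; clear; case: (size g) => [|[]].
have := leq_trans sgf (leq_trans sf Ng).
by move: g1; clear; case: (size g) => [|k] // _; rewrite /= ltnn.
Qed.

(** [rpow p q] is the positive real number [p ^ q].  The absolute value is the
    identity here and only serves to land in the real algebraic numbers. *)
Definition rpow (p : nat) (q : rat) : algR :=
  in_algR (normr_real ((`|denq q|%N).-root ((p%:R : algC) ^ numq q))).

Section RationalPowers.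
Context (p : nat) (p0 : (0 < p)%N).
Implicit Types (q : rat) (m : int) (N : nat).

Lemma rpow_gt0 q : 0 < rpow p q.
Proof.
change (0 < `|(`|denq q|%N).-root ((p%:R : algC) ^ numq q)|).
rewrite normr_gt0 rootC_eq0 ?absz_gt0 ?denq_neq0 //.
by rewrite expfz_neq0 // pnatr_eq0 -lt0n.
Qed.

Lemma rpow_denq q : rpow p q ^+ `|denq q| = p%:R ^ numq q.
Proof.
apply: val_inj; rewrite rmorphXn fmorphXz rmorph_nat /=.
rewrite -normrX rootCK ?absz_gt0 ?denq_neq0 //.
by rewrite ger0_norm // exprz_ge0 // ler0n.
Qed.

Lemma rpow_uniq q N m (y : algR) : (0 < N)%N -> q * N%:R = m%:~R -> 0 < y ->
  y ^+ N = p%:R ^ m -> y = rpow p q.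
Proof.
move=> N0 qE y0 yN; have d0 : (0 < `|denq q|)%N by rewrite absz_gt0 denq_neq0.
have pn0 : (p%:R : algR) != 0 by rewrite pnatr_eq0 -lt0n.
apply/eqP; rewrite -(eqrXn2 (n := N * `|denq q|)) ?muln_gt0 ?N0 //; last 2 first.
- exact: ltW.
- exact/ltW/rpow_gt0.
rewrite exprM yN mulnC exprM rpow_denq !exprnP !exprz_exp.
suff -> : m * `|denq q|%N = numq q * N by [].
apply: (@intr_inj rat).
by rewrite absz_denq !rmorphM /= -qE numqE -pmulrn; ring.
Qed.

Lemma rpowX q N m : q * N%:R = m%:~R -> rpow p q ^+ N = p%:R ^ m.
Proof.
move=> qE; have d0 : (0 < `|denq q|)%N by rewrite absz_gt0 denq_neq0.
have pn0 : (0 : algR) < p%:R by rewrite ltr0n.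
apply/eqP; rewrite -(eqrXn2 d0) ?exprn_ge0 ?exprz_ge0 ?ltW ?rpow_gt0 //.
rewrite exprAC rpow_denq !exprnP !exprz_exp.
suff -> : m * `|denq q|%N = numq q * N by [].
apply: (@intr_inj rat).
by rewrite absz_denq !rmorphM /= -qE numqE -pmulrn; ring.
Qed.

Lemma rpowD q r : rpow p (q + r) = rpow p q * rpow p r.
Proof.
have d0 s : (0 < `|denq s|)%N by rewrite absz_gt0 denq_neq0.
have dE s : s * `|denq s|%:R = (numq s)%:~R.
  by rewrite numqE -{2}absz_denq.
symmetry; apply: (@rpow_uniq _ (`|denq q| * `|denq r|)
   (numq q * `|denq r|%N + numq r * `|denq q|%N)).
- by rewrite muln_gt0 !d0.
- by rewrite natrM rmorphD !rmorphM /= -!dE /=; ring.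
- by rewrite mulr_gt0 ?rpow_gt0.
rewrite exprMn exprM rpow_denq mulnC exprM rpow_denq !exprnP !exprz_exp.
by rewrite -expfzDr // pnatr_eq0 -lt0n.
Qed.

Lemma rpow_int m : rpow p m%:~R = p%:R ^ m.
Proof.
by rewrite -[LHS]expr1 (@rpowX _ _ m) // mulr1.
Qed.

Lemma ratr_lt_rpow (q r : rat) N m : 0 < r -> (0 < N)%N -> q * N%:R = m%:~R ->
  (ratr r < rpow p q) = (r ^+ N < p%:R ^ m).
Proof.
move=> r0 N0 qE; rewrite -(ltr_rat algR) rmorphXn fmorphXz rmorph_nat /=.
by rewrite -(rpowX qE) ltr_pXn2r // nnegrE ltW ?rpow_gt0 ?ltr0q.
Qed.

Lemma rpow_lt_ratr (q r : rat) N m : 0 < r -> (0 < N)%N -> q * N%:R = m%:~R ->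
  (rpow p q < ratr r) = (p%:R ^ m < r ^+ N).
Proof.
move=> r0 N0 qE; rewrite -(ltr_rat algR) rmorphXn fmorphXz rmorph_nat /=.
by rewrite -(rpowX qE) ltr_pXn2r // nnegrE ltW ?rpow_gt0 ?ltr0q.
Qed.

End RationalPowers.

Lemma dense_ratr (a b : algR) : a < b -> exists q : rat, a < ratr q < b.
Proof.
move=> ab; pose N := Num.bound (b - a)^-1.
have N0 : 0 < N%:R :> algR.
  by apply: le_lt_trans (archi_boundP _); rewrite invr_ge0 subr_ge0 ltW.
have bN : 1 < (b - a) * N%:R.
  by rewrite -ltr_pdivrMl ?subr_gt0 // mulr1 archi_boundP // invr_ge0 subr_ge0 ltW.
exists ((Num.floor (a * N%:R) + 1)%:~R / N%:R).
rewrite rmorphM /= fmorphV /= ratr_int ratr_nat ltr_pdivlMr // ltr_pdivrMr //.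
have /andP[f1 f2] := floor_itv (a * N%:R).
rewrite f2 /= intrD; apply: le_lt_trans (lerD f1 (lexx _)) _.
by move: bN; rewrite mulrBl; lra.
Qed.

(** Over a common denominator [N] the [p ^ x] become distinct powers of the [N]-th
    root of [p] with exponents below [N], so a relation between them is a
    polynomial of degree below [N] vanishing at that root. *)
Lemma rpow_free p (xs : seq rat) (c : rat -> rat) : prime p -> uniq xs ->
  (forall x, x \in xs -> 0 <= x < 1) ->
  \sum_(x <- xs) ratr (c x) * rpow p x = 0 -> forall x, x \in xs -> c x = 0.
Proof.
move=> pp uxs xs01 s0; have p0 := prime_gt0 pp.
pose N := (\prod_(x <- xs) `|denq x|)%N.
have N0 : (0 < N)%N.
  by apply: prodn_gt0 => x; rewrite absz_gt0 denq_neq0.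
have dvd x : x \in xs -> (`|denq x| %| N)%N.
  by move=> xx; rewrite /N (big_rem x) //= dvdn_mulr.
pose m x := (`|numq x| * (N %/ `|denq x|))%N.
have mE x : x \in xs -> x * N%:R = (m x)%:R.
  move=> xx; have /andP[x0 _] := xs01 x xx.
  rewrite /m natrM -{1}(divnK (dvd x xx)) natrM mulrCA mulrC; congr (_ * _).
  rewrite -[`|_|%:R]/(`|denq x|%:Z%:~R) absz_denq -[RHS]/(`|numq x|%:Z%:~R).
  by rewrite gez0_abs ?numq_ge0 // numqE.
have Nn0 : N%:R != 0 :> rat by rewrite pnatr_eq0 -lt0n.
have m_inj x y : x \in xs -> y \in xs -> m x = m y -> x = y.
  by move=> xx yx E; apply: (mulIf Nn0); rewrite !mE // E.
have mN x : x \in xs -> (m x < N)%N.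
  move=> xx; have /andP[_ x1] := xs01 x xx.
  by rewrite -(ltr_nat rat) -mE // gtr_pMl // ltr0n.
pose f : {poly rat} := \sum_(x <- xs) c x *: 'X^(m x).
have [y yN yE] : exists2 y : algR, y ^+ N = p%:R &
    forall x, x \in xs -> rpow p x = y ^+ m x.
  have yN : rpow p N%:R^-1 ^+ N = p%:R by rewrite (@rpowX _ p0 _ _ 1) ?mulVf.
  exists (rpow p N%:R^-1) => // x xx.
  symmetry; apply: (@rpow_uniq _ p0 _ N (m x)) => //; first exact: mE.
    by rewrite exprn_gt0 // rpow_gt0.
  by rewrite exprAC yN.
have f0 : f = 0.
  apply: (@small_poly_radical_eq0 p N (algRval y)) => //.
  - by rewrite -rmorphXn yN; exact: rmorph_nat.
  - apply/leq_sizeP => j Nj; rewrite coef_sum big1_seq // => x /andP[_ xx].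
    by rewrite coefZ coefXn; case: eqP => [E|]; rewrite ?mulr0 //; have := mN x xx; lia.
  rewrite /root rmorph_sum horner_sum /=.
  rewrite -[X in _ == X](rmorph0 algRval) -s0 (rmorph_sum algRval); apply/eqP.
  apply: eq_big_seq => x xx; rewrite yE // map_polyZ map_polyXn !hornerE.
  by rewrite (rmorphM algRval) (fmorph_rat algRval) (rmorphXn algRval).
move=> x xx; have : f`_(m x) = 0 by rewrite f0 coef0.
rewrite coef_sum (bigD1_seq x) //= coefZ coefXn eqxx mulr1 big1_seq ?addr0 //.
move=> z /andP[zx zxs]; rewrite coefZ coefXn.
by case: eqP => [/esym/(m_inj _ _ zxs xx) E|]; rewrite ?mulr0 //; rewrite E eqxx in zx.
Qed.

(** * The real value of an element of [P_n] on a block *)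

(** The real algebraic numbers as a rational vector space: linear extension from
    the generators of a block requires a module over the coefficients. *)
Definition algRQ : Type := algR.
HB.instance Definition _ := GRing.Zmodule.on algRQ.

Section AlgRQ.
Implicit Types (c d : rat) (x y : algRQ).
Definition algRQ_scale c x : algRQ := (ratr c : algR) * x.
Fact algRQ_scaleA c d x : algRQ_scale c (algRQ_scale d x) = algRQ_scale (c * d) x.
Proof. by rewrite /algRQ_scale rmorphM mulrA. Qed.
Fact algRQ_scale1 x : algRQ_scale 1 x = x.
Proof. by rewrite /algRQ_scale rmorph1 mul1r. Qed.
Fact algRQ_scaleDr c x y : algRQ_scale c (x + y) = algRQ_scale c x + algRQ_scale c y.
Proof. exact: mulrDr. Qed.
Fact algRQ_scaleDl x c d : algRQ_scale (c + d) x = algRQ_scale c x + algRQ_scale d x.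
Proof. by rewrite /algRQ_scale rmorphD mulrDl. Qed.
HB.instance Definition _ := GRing.Zmodule_isLmodule.Build rat algRQ
  algRQ_scaleA algRQ_scale1 algRQ_scaleDr algRQ_scaleDl.
End AlgRQ.

Section BlockValue.
Context (n : nat) (p : 'I_n -> nat) (p_prime : forall i, prime (p i)).
Implicit Types (h g : Pgrp n) (i : 'I_n) (z : int) (b : 'I_n * int).

(** The image in the reals of the component of [h] in the block [b]. *)
Definition bval h b : algR :=
  fglift (fun t : int * X =>
    (if t.1 == b.2 then rpow (p b.1) (t.2 : Dyadic) else 0) : algRQ) (h b.1).

Lemma bvalD h g b : bval (h + g) b = bval h b + bval g b.
Proof. by rewrite /bval ffunE raddfD. Qed.

Lemma bvalN h b : bval (- h) b = - bval h b.
Proof. by rewrite /bval ffunE raddfN. Qed.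

Lemma bval0 b : bval 0 b = 0.
Proof. by rewrite /bval ffunE raddf0. Qed.

Lemma bvalB h g b : bval (h - g) b = bval h b - bval g b.
Proof. by rewrite bvalD bvalN. Qed.

Lemma bval_h i r z (x : X) b :
  bval (h_elt i r z x) b =
  if (i, z) == b then ratr r * rpow (p i) (x : Dyadic) else 0.
Proof.
case: b => j w; rewrite /bval ffunE xpair_eqE eq_sym /=.
case: eqP => [->|_]; last by rewrite raddf0.
rewrite liftU /=; case: eqP => _ //; exact: mulr0.
Qed.

Lemma h_elt_sum h : h = \sum_i \sum_(t <- dom (h i)) h_elt i (coeff t (h i)) t.1 t.2.
Proof.
apply/ffunP => j; rewrite sum_ffunE (bigD1 j) //= [X in _ + X]big1 ?addr0.
  rewrite sum_ffunE -[LHS]freeg_sumE; apply: eq_bigr => -[z x] _.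
  by rewrite ffunE eqxx.
move=> i ij; rewrite sum_ffunE big1 // => t _; rewrite ffunE.
by rewrite eq_sym (negbTE ij).
Qed.

Lemma h_elt_ind (Q : Pgrp n -> Prop) h : Q 0 -> (forall g f, Q g -> Q f -> Q (g + f)) ->
  (forall i z x, coeff (z, x) (h i) != 0 -> Q (h_elt i (coeff (z, x) (h i)) z x)) -> Q h.
Proof.
move=> Q0 QD Qh; rewrite [h]h_elt_sum; apply: big_ind => // i _.
rewrite big_seq_cond; apply: big_ind => // -[z x]; rewrite andbT mem_dom => cn0.
exact: Qh.
Qed.

Lemma eq_on_h_elt (M : zmodType) (F G : Pgrp n -> M) :
  {morph F : h g / h + g} -> {morph G : h g / h + g} ->
  (forall i r z x, F (h_elt i r z x) = G (h_elt i r z x)) -> F =1 G.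
Proof.
move=> FD GD FG h; have F0 : F 0 = 0 by apply: (@addrI _ (F 0)); rewrite -FD !addr0.
have G0 : G 0 = 0 by apply: (@addrI _ (G 0)); rewrite -GD !addr0.
apply: (@h_elt_ind (fun h => F h = G h)) => [|g f Eg Ef|i z x _] //.
  by rewrite F0 G0.
by rewrite FD GD Eg Ef.
Qed.

Lemma zeta_act_h (k : int) i r z (x : X) :
  zeta_act k (h_elt i r z x) = h_elt i r (z + k) x.
Proof.
apply/ffunP => j; rewrite !ffunE; case: eqP => _; last by rewrite raddf0.
by rewrite liftU freegZU mulr1.
Qed.

Lemma lambda_act_h a i r z (x : X) :
  let y : Dyadic := (x : Dyadic) + mul2z a z in
  lambda_act p a (h_elt i r z x) =
  h_elt i (r * (p i)%:R ^ dyadic_floor y) z (dyadic_frac y).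
Proof.
apply/ffunP => j; rewrite !ffunE; case: eqP => [->|_]; last by rewrite raddf0.
by rewrite liftU freegZU.
Qed.

Lemma bval_lambda a h i z :
  bval (lambda_act p a h) (i, z) = rpow (p i) ((a : rat) * 2 ^ z) * bval h (i, z).
Proof.
move: h; apply: eq_on_h_elt => [h g|h g|j r w x].
- by rewrite lambda_actD bvalD.
- by rewrite bvalD mulrDr.
rewrite lambda_act_h !bval_h; case: eqP => [[-> ->]|_]; last by rewrite mulr0.
have pi0 := prime_gt0 (p_prime i).
rewrite rmorphM fmorphXz rmorph_nat -mulrA -(rpow_int pi0) -(rpowD pi0).
rewrite mulrCA -(rpowD pi0); congr (_ * rpow _ _) => /=.
rewrite /dyadic_floor /=; ring.
Qed.

Lemma bval_zeta (k : int) h i z : bval (zeta_act k h) (i, z) = bval h (i, z - k).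
Proof.
move: h; apply: eq_on_h_elt => [h g|h g|j r w x].
- by rewrite zeta_actD bvalD.
- by rewrite bvalD.
by rewrite zeta_act_h !bval_h !xpair_eqE [w == _]eq_sym subr_eq [z == _]eq_sym.
Qed.

(** The identification of a block with a field of real numbers is injective. *)
Lemma bval_coeff h i z : bval h (i, z) = 0 -> forall x, coeff (z, x) (h i) = 0.
Proof.
move=> v0 x; apply: contrapT => /eqP cn0.
pose tq (t : int * X) : rat := (t.2 : Dyadic).
pose s := [seq t <- dom (h i) | t.1 == z].
have zxs : (z, x) \in s by rewrite mem_filter eqxx mem_dom.
pose c (q : rat) := \sum_(t <- s | tq t == q) coeff t (h i).
have tq_inj : {in s &, injective tq}.
  move=> [z1 x1] [z2 x2]; rewrite !mem_filter /= => /andP[/eqP-> _] /andP[/eqP-> _].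
  by rewrite /tq /= => /val_inj/val_inj ->.
have cE t : t \in s -> c (tq t) = coeff t (h i).
  move=> ts; rewrite /c big_mkcond (bigD1_seq t) ?filter_uniq ?uniq_dom //= eqxx.
  rewrite big1_seq ?addr0 // => u /andP[ut us]; case: eqP => // /tq_inj E.
  by rewrite E ?eqxx in ut.
have c0 : forall q, q \in map tq s -> c q = 0.
  apply: (@rpow_free (p i)) => //.
  - by rewrite map_inj_in_uniq // filter_uniq ?uniq_dom.
  - by move=> _ /mapP[t _ ->]; have := valP t.2; rewrite unfold_in.
  rewrite big_map -[RHS]v0 /bval -[h i in RHS]freeg_sumE raddf_sum big_filter big_mkcond.
  apply: eq_big_seq => t td; rewrite [RHS]liftU /=.
  by case: eqP => [E|_]; rewrite ?scaler0 // cE // mem_filter E eqxx.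
have := c0 (tq (z, x)); rewrite map_f // cE // => /(_ isT) E.
by rewrite E eqxx in cn0.
Qed.

Lemma bval_eq0 h : (forall b, bval h b = 0) -> h = 0.
Proof.
move=> v0; apply/ffunP => i; rewrite ffunE; apply/eqP/freeg_eqP => -[z x].
by rewrite coeff0 (bval_coeff (v0 (i, z))).
Qed.

Lemma bval_support h : exists s : seq ('I_n * int), forall b, b \notin s -> bval h b = 0.
Proof.
apply: (@h_elt_ind (fun h => exists s : seq ('I_n * int),
    forall b, b \notin s -> bval h b = 0) h) => [|g f [s sP] [t tP]|i z x _].
- by exists [::] => b _; rewrite bval0.
- exists (s ++ t) => b; rewrite mem_cat negb_or => /andP[/sP + /tP].
  by rewrite bvalD => -> ->; rewrite addr0.
- exists [:: (i, z)] => b; rewrite inE bval_h eq_sym.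
  by case: eqP.
Qed.

End BlockValue.

(** * Comparing elements of an ordered group by conjugation *)

Section GroupCone.
Context (G : groupType) (P : set G) (hP : positive_cone P).
Implicit Types g h : G.
Local Open Scope group_scope.

Lemma cone_expg g m : P g -> P (g ^+ m.+1).
Proof.
move=> Pg; elim: m => [|m IH]; first by rewrite expg1.
by rewrite expgS; exact: cone_mul.
Qed.

Lemma cone_total g : g <> 1 -> ~ P g -> P g^-1.
Proof. by move=> g1 nP; case: (cone_cover hP g). Qed.

Lemma cone_expgI g m : P (g ^+ m.+1) -> P g.
Proof.
move=> Pgm; apply: contrapT => nPg.
have [g1|g1] := pselect (g = 1).
  by move: Pgm; rewrite g1 expg1n; exact: cone_not1.
have := cone_expg m (cone_total g1 nPg).
by rewrite expVgn; exact: (cone_not_inv hP).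
Qed.

Lemma cone_lt_expg g h m : P (g^-1 * h) -> P ((g ^+ m.+1)^-1 * h ^+ m.+1).
Proof.
move=> gh; elim: m => [|m IH]; first by rewrite !expg1.
have := cone_mul hP (cone_conj hP g^-1 IH) gh.
rewrite invgK (expgSr g m.+1) (expgSr h m.+1) invgM.
move: (g ^+ m.+1) (h ^+ m.+1) => a b.
by rewrite !mulgA mulgK.
Qed.

(** Were [1 < g <= h], then [g^-1 h g < h g <= h^2] and likewise
    [g h g^-1 < g h <= h^2], so neither conjugate could be [h ^ m] with
    [m >= 2]. *)
Lemma cone_lt_conj g h m : P g -> P h -> (1 < m)%N ->
  h ^ g = h ^+ m \/ h ^ g^-1 = h ^+ m -> P (h^-1 * g).
Proof.
move=> Pg Ph m1 E; apply: contrapT => nP.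
have gh : g = h \/ P (h * g^-1).
  have [->|gh] := pselect (g = h); first by left.
  right; have /(cone_conj hP h) : P (h^-1 * g)^-1.
    by apply: cone_total nP => E1; apply: gh; rewrite -(mulVKg h g) E1 mulg1.
  by rewrite invgM invgK mulgA -[h * _ * _ * _]mulgA mulgV mulg1.
have hm : P (h ^+ 2 * (h ^+ m)^-1).
  case: E => <-.
  - have -> : h ^+ 2 * (h ^ g)^-1 = h * (h * g^-1) * h^-1 * g.
      by rewrite conjgE !invgM invgK expgS expg1 !mulgA.
    case: gh => [->|hg]; first by rewrite mulgV mulg1 mulgV mul1g.
    by apply: cone_mul => //; exact: cone_conj.
  - have -> : h ^+ 2 * (h ^ g^-1)^-1 = h ^+ 2 * g * (h ^+ 2)^-1 * (h * g^-1).
      by rewrite conjgE !invgM !invgK expgS expg1 !mulgA mulgVK.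
    have Pc := cone_conj hP (h ^+ 2) Pg.
    case: gh => [E|hg]; last exact: cone_mul.
    by move: Pc; rewrite E mulgV mulg1.
case: m m1 {E} hm => [|[|m]] // _.
have -> : h ^+ 2 * (h ^+ m.+2)^-1 = (h ^+ m)^-1.
  by rewrite -(addn2 m) expgnDr invgM mulVKg.
case: m => [|m]; first by rewrite expg0 invg1; exact: cone_not1.
by move=> /(cone_not_inv hP); rewrite invgK; apply; exact: cone_expg.
Qed.

End GroupCone.

Definition X0 : X := dyadic_frac 0.

Lemma X0E : ((X0 : Dyadic) : rat) = 0.
Proof. by rewrite /= /dyadic_floor /= floor0 subr0. Qed.

Section Module.
Context (n : nat) (p : 'I_n -> nat).
Implicit Types (h g : Pgrp n) (i : 'I_n) (z : int) (r q : rat).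

Lemma h_eltZ q i r z (x : X) : q *: h_elt i r z x = h_elt i (q * r) z x.
Proof.
apply/ffunP => j; rewrite !ffunE; case: eqP => _; last exact: scaler0.
by rewrite freegZU.
Qed.

Lemma lambda_actZ a q h : lambda_act p a (q *: h) = q *: lambda_act p a h.
Proof.
move: h; apply: eq_on_h_elt => [h g|h g|i r z x].
- by rewrite scalerDr lambda_actD.
- by rewrite lambda_actD scalerDr.
by rewrite h_eltZ !lambda_act_h h_eltZ mulrA.
Qed.

Lemma lambda_actB a h g : lambda_act p a (h - g) = lambda_act p a h - lambda_act p a g.
Proof. by rewrite lambda_actD lambda_actN. Qed.

Lemma zeta_actB a h g : zeta_act a (h - g) = zeta_act a h - zeta_act a g.
Proof. by rewrite zeta_actD zeta_actN. Qed.

(** On the block [(i, z)], the element [lambda^(2^-z)] acts as multiplication by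
    [p_i]. *)
Lemma lambda_act_int (a : Dyadic) i r z (m : int) : (a : rat) * 2 ^ z = m%:~R ->
  lambda_act p a (h_elt i r z X0) = (p i)%:R ^ m *: h_elt i r z X0.
Proof.
move=> aE; rewrite lambda_act_h h_eltZ mulrC.
have -> : (X0 : Dyadic) + mul2z a z = (X0 : Dyadic) - int_dyadic (- m).
  by apply: val_inj; rewrite /= aE intrN opprK.
by rewrite dyadic_floorD dyadic_fracD dyadic_floorX dyadic_fracX opprK add0r.
Qed.

Lemma lambda_act_X0 i r z (x : X) :
  lambda_act p (mul2z (x : Dyadic) (- z)) (h_elt i r z X0) = h_elt i r z x.
Proof.
rewrite lambda_act_h.
have -> : (X0 : Dyadic) + mul2z (mul2z (x : Dyadic) (- z)) z = x.
  by rewrite mul2zA addNr mul2z0; apply: val_inj; rewrite /= -[RHS]add0r -X0E.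
by rewrite dyadic_floorX dyadic_fracX expr0z mulr1.
Qed.

End Module.

(** * The restriction of an order to [P_n] *)

Definition block n : Type := ('I_n * int)%type.

Record block_order n (R : rel (block n)) : Prop := BlockOrder {
  block_irr : forall b, ~~ R b b;
  block_trans : transitive R;
  block_total : forall b c, b != c -> R b c || R c b;
  block_shift : forall i j z w k, R (i, z + k) (j, w + k) = R (i, z) (j, w)
}.

Definition sgn {R : pzRingType} {n} (eps : pred 'I_n) i : R := (-1) ^+ eps i.

Lemma dyadic_valMn (a : Dyadic) N : (a *+ N : Dyadic) = (a : rat) *+ N :> rat.
Proof. by elim: N => [|N IH] //; rewrite !mulrS -IH. Qed.

Section ConeOnModule.
Context (n : nat) (p : 'I_n -> nat) (p_prime : forall i, prime (p i)).
Context (P : Gn p_prime -> bool) (hP : positive_cone [set g | P g]).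
Implicit Types (x : X) (h u v : Pgrp n) (b c : block n) (i j : 'I_n) (z w : int) (q r : rat).

Local Notation C h := (P (of_P p_prime h)).

Lemma Pcone0 : ~~ C 0. Proof. exact/negP/(cone_not1 hP). Qed.

Lemma of_PN h : of_P p_prime (- h) = ((of_P p_prime h)^-1)%g.
Proof.
by apply: (@mulgI _ (of_P p_prime h)); rewrite mulgV -of_PD subrr.
Qed.

Lemma PconeD u v : C u -> C v -> C (u + v).
Proof. by rewrite of_PD; exact: cone_mul hP _ _. Qed.

Lemma PconeN u : C u -> ~~ C (- u).
Proof. by rewrite of_PN => Cu; apply/negP/(cone_not_inv hP Cu). Qed.

Lemma Pcone_total u : u != 0 -> ~~ C u -> C (- u).
Proof.
rewrite of_PN => u0 nCu; apply: (cone_total hP); last exact/negP.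
by case=> /eqP; rewrite (negbTE u0).
Qed.

Lemma Pcone_notin u : ~~ C u -> u = 0 \/ C (- u).
Proof.
by move=> nC; case: (eqVneq u 0) => [|u0]; [left | right; exact: Pcone_total].
Qed.

Lemma Pcone_notinD u v : ~~ C u -> ~~ C v -> ~~ C (u + v).
Proof.
move=> /Pcone_notin[->|Cu]; first by rewrite add0r.
move=> nCv; apply: contra nCv => Cuv; have := PconeD Cu Cuv.
by rewrite addKr.
Qed.

Lemma Pcone_conj (g : Gn p_prime) u v : (of_P p_prime u ^ g)%g = of_P p_prime v ->
  C v = C u.
Proof.
move=> uv; apply/idP/idP => [Cv|Cu].
  by have := cone_conj hP g Cv; rewrite /= -uv conjgE mulVKg mulgK.
by have := cone_conj hP g^-1 Cu; rewrite /= -uv conjgE invgK mulgA.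
Qed.

Lemma Pcone_lambda a u : C (lambda_act p a u) = C u.
Proof. exact: Pcone_conj (conj_lambda_P _ _ _). Qed.

Lemma Pcone_zeta k u : C (zeta_act k u) = C u.
Proof. exact: Pcone_conj (conj_zeta_P _ _ _). Qed.

Lemma Pcone_natmul u m : C u -> C (m.+1%:R *: u).
Proof.
move=> Cu; elim: m => [|m IH]; first by rewrite scale1r.
by rewrite -[m.+2]addn1 natrD scalerDl scale1r; exact: PconeD.
Qed.

Lemma PconeZ q u : 0 < q -> C (q *: u) = C u.
Proof.
move=> q0; suff H r v : 0 < r -> C v -> C (r *: v).
  apply/idP/idP => [|Cu]; last exact: H.
  by move=> /(H q^-1); rewrite invr_gt0 scalerA mulVf ?gt_eqF // scale1r; apply.
move: r v {q0} => {}q {}u q0 Cu; case: (boolP (C (q *: u))) => // /Pcone_notin[/eqP|].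
  rewrite scaler_eq0 gt_eqF //= => /eqP u0.
  by rewrite u0 (negbTE Pcone0) in Cu.
have [m [k ->]] : exists m k, q = m.+1%:R / k.+1%:R.
  exists `|numq q|.-1, `|denq q|.-1.
  rewrite !prednK ?absz_gt0 ?denq_neq0 ?gt_eqF ?numq_gt0 //.
  rewrite -[LHS]divq_num_den; congr (_ / _).
    by rewrite -[RHS]/(`|numq q|%:Z%:~R) gez0_abs // numq_ge0 ltW.
  by rewrite -[RHS]/(`|denq q|%:Z%:~R) absz_denq.
move=> /(Pcone_natmul k); rewrite scalerN scalerA mulrC divfK ?pnatr_eq0 //.
by move=> /PconeN; rewrite opprK Pcone_natmul.
Qed.

Lemma PconeZ_ge0 q u : 0 <= q -> C u -> ~~ C (- (q *: u)).
Proof.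
rewrite le_eqVlt => /predU1P[<-|q0] Cu; first by rewrite scale0r oppr0 Pcone0.
by apply: PconeN; rewrite PconeZ.
Qed.

Lemma PconeD_ge0 u v : C u -> ~~ C (- v) -> C (u + v).
Proof.
move=> Cu /Pcone_notin[/eqP|]; first by rewrite oppr_eq0 => /eqP->; rewrite addr0.
by rewrite opprK; exact: PconeD.
Qed.

(** The sign of the index [i]; shift invariance makes it common to all the blocks
    [(i, z)]. *)
Definition cone_eps : pred 'I_n := fun i => ~~ C (h_elt i 1 0 X0).
Local Notation sg i := (sgn cone_eps i).

(** The one of [h^{i,1}_{z,x}] and [h^{i,-1}_{z,x}] that is positive. *)
Definition pos_gen b (x : X) : Pgrp n := h_elt b.1 (sg b.1) b.2 x.

Local Notation pos := pos_gen.

Lemma lambda_pos b x : lambda_act p (mul2z (x : Dyadic) (- b.2)) (pos b X0) = pos b x.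
Proof. exact: lambda_act_X0. Qed.

Lemma zeta_pos k i z x : zeta_act k (pos (i, z) x) = pos (i, z + k) x.
Proof. exact: zeta_act_h. Qed.

Lemma h_elt_neq0 i r z (x : X) : r != 0 -> h_elt i r z x != 0.
Proof.
apply: contra_neq => /(congr1 (fun h : Pgrp n => h i)).
by rewrite !ffunE eqxx => /eqP; rewrite freegU_eq0 => /eqP.
Qed.

Lemma Pcone_pos b x : C (pos b x).
Proof.
rewrite -lambda_pos Pcone_lambda; case: b => i z.
rewrite -[z]add0r -zeta_pos Pcone_zeta /pos_gen /sgn /cone_eps /=.
case: (boolP (C (h_elt i 1 0 X0))) => //= /Pcone_total; rewrite h_elt_neq0 //.
by move=> /(_ isT); rewrite -scaleN1r h_eltZ mulr1.
Qed.

Lemma bval_pos b x c :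
  bval p (pos b x) c = if b == c then sgn cone_eps b.1 * rpow (p b.1) (x : Dyadic) else 0.
Proof.
rewrite /pos_gen bval_h -surjective_pairing; case: eqP => // _.
by rewrite /sgn rmorphXn rmorphN1.
Qed.

(** For an order-preserving linear map [T], here [lambda^a], [T u <= q u] implies
    [T^N u <= q^N u].  The factor [t] covers the reverse inequality as well. *)
Lemma lambda_iter_le (a : Dyadic) q t u N : 0 < q ->
  ~~ C (t *: (lambda_act p a u - q *: u)) ->
  ~~ C (t *: (lambda_act p (a *+ N) u - q ^+ N *: u)).
Proof.
move=> q0 le1; elim: N => [|N IH].
  by rewrite expr0 mulr0n lambda_act_id scale1r subrr scaler0 Pcone0.
have -> : t *: (lambda_act p (a *+ N.+1) u - q ^+ N.+1 *: u) =
    lambda_act p (a *+ N) (t *: (lambda_act p a u - q *: u)) +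
    q *: (t *: (lambda_act p (a *+ N) u - q ^+ N *: u)).
  rewrite lambda_actZ lambda_actB lambda_actZ (lambda_act_comp p_prime) -mulrS.
  rewrite !scalerBr !scalerA [t * q]mulrC addrA subrK.
  by congr (_ - _ *: _); rewrite exprS; ring.
by apply: Pcone_notinD; [rewrite Pcone_lambda | rewrite PconeZ].
Qed.

(** The map carrying the generator at [0] to the one at [x] has [denq x] as a power
    acting as multiplication by [p ^ numq x]. *)
Lemma pos_cmp b x q t : 0 < q -> ~~ C (t *: (pos b x - q *: pos b X0)) ->
  t * ((p b.1)%:R ^ numq (x : Dyadic) - q ^+ `|denq (x : Dyadic)|) <= 0.
Proof.
move=> q0; rewrite -lambda_pos => /(lambda_iter_le `|denq (x : Dyadic)|).
move=> /(_ q0); rewrite /pos_gen (lambda_act_int p _ _ (m := numq (x : Dyadic))); last first.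
  rewrite dyadic_valMn /=.
  rewrite mulrnAl -mulrA -expfzDr // addNr expr0z mulr1 numqE -[LHS]mulr_natr.
  by rewrite -[X in _ * X = _]/(Posz `|denq (x : Dyadic)|)%:~R absz_denq.
rewrite -scalerBl scalerA leNgt; apply: contra => c1; rewrite PconeZ //; exact: Pcone_pos b _.
Qed.

Lemma pos_gt b x q : 0 < q -> ratr q < rpow (p b.1) (x : Dyadic) ->
  C (pos b x - q *: pos b X0).
Proof.
move=> q0; rewrite (ratr_lt_rpow (prime_gt0 (p_prime _)) q0 (N := `|denq (x : Dyadic)|)
  (m := numq (x : Dyadic))) ?absz_gt0 ?denq_neq0 //; last first.
  by rewrite numqE -[X in _ * X]/(`|_|%:Z%:~R) absz_denq.
move=> lt; apply: contraLR lt => nC; rewrite -leNgt -subr_le0.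
by have := @pos_cmp b x q 1 q0; rewrite scale1r mul1r => /(_ nC).
Qed.

Lemma pos_lt b x q : 0 < q -> rpow (p b.1) (x : Dyadic) < ratr q ->
  C (q *: pos b X0 - pos b x).
Proof.
move=> q0; rewrite (rpow_lt_ratr (prime_gt0 (p_prime _)) q0 (N := `|denq (x : Dyadic)|)
  (m := numq (x : Dyadic))) ?absz_gt0 ?denq_neq0 //; last first.
  by rewrite numqE -[X in _ * X]/(`|_|%:Z%:~R) absz_denq.
move=> lt; apply: contraLR lt => nC; rewrite -leNgt -subr_le0.
by have := @pos_cmp b x q (-1) q0; rewrite scaleN1r opprB mulN1r opprB => /(_ nC).
Qed.

(** Comparing single generators is enough to compare blocks up to infinitesimals,
    see [cone_rel_dominates]. *)
Definition cone_rel : rel (block n) := fun b c => C (pos c X0 - pos b X0).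

Lemma cone_rel_order : block_order cone_rel.
Proof.
split=> [b|b c d|b c bc|i j z w k].
- by rewrite /cone_rel subrr Pcone0.
- by rewrite /cone_rel => H1 H2; have := PconeD H2 H1; rewrite addrA subrK.
- rewrite /cone_rel; case: (boolP (C (pos c X0 - pos b X0))) => //= /Pcone_total.
  rewrite opprB; apply; apply/negP => /eqP /(congr1 (fun h => bval p h b)).
  rewrite bvalB bval0 !bval_pos eqxx eq_sym (negbTE bc) sub0r => /eqP.
  by rewrite oppr_eq0 mulf_eq0 signr_eq0 gt_eqF // rpow_gt0 // prime_gt0.
- by rewrite /cone_rel -!zeta_pos -zeta_actB Pcone_zeta.
Qed.

End ConeOnModule.

(** * Dominance between blocks *)

Lemma exp_unbounded (t k : rat) : 1 < t -> exists m, k < t ^+ m.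
Proof.
move=> t1; have bern m : 1 + m%:R * (t - 1) <= t ^+ m.
  elim: m => [|m IH]; first by rewrite mul0r addr0 expr0.
  rewrite exprS; apply: le_trans (ler_wpM2l _ IH); last by apply: ltW; lra.
  have : 0 <= m%:R * (t - 1) * (t - 1) by rewrite !mulr_ge0 ?ler0n //; lra.
  by rewrite -[m.+1]addn1 natrD; lra.
have [m km] : exists m, k < m%:R * (t - 1).
  exists (Num.bound `|k / (t - 1)|).
  rewrite -ltr_pdivrMr ?subr_gt0 //; apply: le_lt_trans (ler_norm _) _.
  exact: archi_boundP (normr_ge0 _).
by exists m; have := bern m; lra.
Qed.

Section ConeStructure.
Context (n : nat) (p : 'I_n -> nat) (p_prime : forall i, prime (p i)).
Context (p_inj : injective p).
Context (P : Gn p_prime -> bool) (hP : positive_cone [set g | P g]).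
Implicit Types (x : X) (h u v : Pgrp n) (b c : block n) (i j : 'I_n) (z w : int) (q r : rat).

Local Notation C h := (P (of_P p_prime h)).
Local Notation sg i := (sgn (cone_eps P) i).
Local Notation pos := (pos_gen P).

(** A suitable [lambda^a] multiplies the two blocks by distinct integers [mu] and
    [nu]; applying it to [k u < v] gives [k (mu / nu) u < v], and conversely, so
    that [k] can be replaced by [k (mu / nu) ^ m] for every integer [m]. *)
Lemma cone_rel_dominates b c k : cone_rel P b c -> C (pos c X0 - k *: pos b X0).
Proof.
rewrite /cone_rel => Dbc; pose D k := C (pos c X0 - k *: pos b X0).
have D1 : D 1 by rewrite /D scale1r.
have D_le k1 k2 : k1 <= k2 -> D k2 -> D k1.
  move=> k12 Dk2; rewrite /D.
  rewrite (_ : _ - _ = (pos c X0 - k2 *: pos b X0) + (k2 - k1) *: pos b X0).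
    apply: (PconeD_ge0 hP) Dk2 _; apply: (PconeZ_ge0 hP); rewrite ?subr_ge0 //.
    exact: (Pcone_pos hP).
  by rewrite scalerBl addrA subrK.
(* [2 ^ K] clears the denominators of both [2 ^ b.2] and [2 ^ c.2]. *)
pose K : int := (`|b.2| + `|c.2|)%N; pose a := mul2z (int_dyadic 1) K.
have aE z (s : nat) : z + K = s -> (a : rat) * 2 ^ z = (2 ^ s)%N%:Z%:~R.
  by move=> zE; rewrite /= mul1r -expfzDr // addrC zE -[RHS]/((2 ^ s)%N%:R) natrX.
have [s sE] : exists s : nat, b.2 + K = s by exists (absz (b.2 + K)); rewrite /K; lia.
have [t tE] : exists t : nat, c.2 + K = t by exists (absz (c.2 + K)); rewrite /K; lia.
pose mu : rat := (p b.1)%:R ^+ (2 ^ s); pose nu : rat := (p c.1)%:R ^+ (2 ^ t).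
have mu0 : 0 < mu by rewrite exprn_gt0 // ltr0n prime_gt0.
have nu0 : 0 < nu by rewrite exprn_gt0 // ltr0n prime_gt0.
have munu : mu != nu.
  rewrite /mu /nu -!natrX eqr_nat; apply: contraNneq (block_irr (cone_rel_order hP) b).
  move=> E; suff bc : b = c by rewrite -bc in Dbc.
  have pbc : p b.1 = p c.1.
    apply/eqP; rewrite -(dvdn_prime2 (p_prime b.1) (p_prime c.1)).
    have : (p b.1 %| p c.1 ^ (2 ^ t))%N by rewrite -E dvdn_exp // expn_gt0.
    by rewrite Euclid_dvdX // => /andP[].
  move: E; rewrite pbc => /eqP; rewrite eqn_exp2l ?prime_gt1 // eqn_exp2l // => /eqP st.
  move: (b) (c) (p_inj pbc) sE tE; rewrite -st => -[i z] [j w] /= -> <- /addIr ->.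
  by [].
have DE k1 : D k1 = D (k1 * (mu / nu)).
  rewrite /D -(Pcone_lambda hP a) lambda_actB lambda_actZ /pos_gen.
  rewrite (lambda_act_int _ _ _ (aE _ _ sE)) (lambda_act_int _ _ _ (aE _ _ tE)).
  rewrite -!exprnP -/mu -/nu scalerA -[RHS](PconeZ hP _ nu0) scalerBr scalerA.
  by congr (P (of_P _ (_ - _ *: _))); field; rewrite gt_eqF.
have DX m k1 : D k1 = D (k1 * (mu / nu) ^+ m).
  by elim: m => [|m IH]; [rewrite expr0 mulr1 | rewrite IH DE -mulrA -exprSr].
have DXV m k1 : D k1 = D (k1 * (nu / mu) ^+ m).
  rewrite [RHS](DX m) -mulrA -exprMn mulrA divfK ?gt_eqF // divff ?gt_eqF //.
  by rewrite expr1n mulr1.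
have := munu; rewrite neq_lt => /orP[lt|lt].
  have /(exp_unbounded k) [m /ltW km] : 1 < nu / mu by rewrite ltr_pdivlMr ?mul1r.
  by apply: D_le km _; rewrite -[_ ^+ _]mul1r -DXV.
have /(exp_unbounded k) [m /ltW km] : 1 < mu / nu by rewrite ltr_pdivlMr ?mul1r.
by apply: D_le km _; rewrite -[_ ^+ _]mul1r -DX.
Qed.

(** [u] is at least its real value on [b] times the generator of [b], up to
    infinitesimals.  This one-sided form is closed under addition, so that it can
    be checked on the generators of [P_n]. *)
Definition above_value b u := forall q, ratr q < sg b.1 * bval p u b ->
  C (u - q *: pos b X0).

Lemma above_value0 b : above_value b 0.
Proof.
move=> q; rewrite bval0 mulr0 ltrq0 => q0; rewrite sub0r -scaleNr (PconeZ hP) ?oppr_gt0 //.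
exact: (Pcone_pos hP).
Qed.

Lemma above_valueD b u v : above_value b u -> above_value b v -> above_value b (u + v).
Proof.
move=> Gu Gv q; rewrite bvalD mulrDr -ltrBlDr => /dense_ratr [q1 /andP[qq1 q1u]].
rewrite (_ : u + v - _ = (u - q1 *: pos b X0) + (v - (q - q1) *: pos b X0)).
  by apply: (PconeD hP); [exact: Gu | apply: Gv; rewrite rmorphB /=; lra].
by rewrite scalerBl opprB [RHS]addrACA addKr.
Qed.

Lemma sgnM (R : pzRingType) (eps : pred 'I_n) i : sgn eps i * sgn eps i = 1 :> R.
Proof. by rewrite /sgn -expr2 sqrr_sign. Qed.

Lemma h_elt_pos i r z x : h_elt i r z x = (sg i * r) *: pos (i, z) x.
Proof. by rewrite h_eltZ mulrAC sgnM mul1r. Qed.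

Lemma above_value_same b q x : q != 0 -> above_value b (q *: pos b x).
Proof.
move=> q0 r; have -> : sg b.1 * bval p (q *: pos b x) b =
    ratr q * rpow (p b.1) (x : Dyadic) :> algR.
  rewrite h_eltZ bval_h -surjective_pairing eqxx.
  have -> : ratr (q * sg b.1) = ratr q * sg b.1 :> algR.
    by rewrite rmorphM /= /sgn rmorphXn rmorphN1.
  by rewrite mulrCA -mulrA [sgn _ _ * (sgn _ _ * _)]mulrA sgnM mul1r.
have e0 : 0 < rpow (p b.1) (x : Dyadic) by rewrite rpow_gt0 // prime_gt0.
case: (ltgtP 0 q) q0 => // q0 _ rq.
- have /dense_ratr [s /andP[]] : Num.max 0 (ratr (r / q)) < rpow (p b.1) (x : Dyadic).
    rewrite gt_max e0 /= rmorphM fmorphV /= ltr_pdivrMr ?ltr0q //.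
    by rewrite mulrC.
  rewrite gt_max ltr0q ltr_rat => /andP[s0 rs] sx.
  rewrite (_ : _ - _ = q *: (pos b x - s *: pos b X0) + (q * s - r) *: pos b X0).
    apply: (PconeD_ge0 hP); first by rewrite (PconeZ hP) // (pos_gt hP).
    apply: (PconeZ_ge0 hP); last exact: (Pcone_pos hP).
    by move: rs; rewrite ltr_pdivrMr // mulrC subr_ge0 => /ltW.
  by rewrite scalerBl scalerBr scalerA addrA subrK.
- have rx : rpow (p b.1) (x : Dyadic) < ratr (r / q).
    rewrite rmorphM fmorphV /= ltr_ndivlMr ?ltrq0 //.
    by rewrite mulrC.
  rewrite (_ : q *: pos b x - r *: pos b X0 = (- q) *: ((r / q) *: pos b X0 - pos b x)).
    rewrite (PconeZ hP) ?oppr_gt0 // (pos_lt hP) //.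
    by rewrite -(ltr0q algR) (lt_trans e0).
  by rewrite scalerBr scalerA !scaleNr opprK addrC mulNr mulrC divfK ?lt_eqF // scaleNr.
Qed.

Lemma above_value_below b c q x : cone_rel P c b -> above_value b (q *: pos c x).
Proof.
move=> cb r; have cb' : c == b = false.
  by apply: contraTF cb => /eqP->; exact: (block_irr (cone_rel_order hP)).
have -> : bval p (q *: pos c x) b = 0 by rewrite h_eltZ bval_h -surjective_pairing cb'.
rewrite mulr0 ltrq0 => r0.
have e0 : 0 < rpow (p c.1) (x : Dyadic) by rewrite rpow_gt0 // prime_gt0.
have /dense_ratr [s /andP[sx _]] : rpow (p c.1) (x : Dyadic) < rpow (p c.1) (x : Dyadic) + 1.
  by rewrite ltrDl.
have s0 : 0 < s by rewrite -(ltr0q algR) (lt_trans e0).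
have nr0 : 0 < - r by rewrite oppr_gt0.
rewrite -scaleNr addrC; case: (lerP 0 q) => q0.
  apply: (PconeD_ge0 hP); first by rewrite (PconeZ hP) //; exact: (Pcone_pos hP).
  by apply: (PconeZ_ge0 hP) => //; exact: (Pcone_pos hP).
rewrite (_ : _ + _ = (- r) *: (pos b X0 - ((- q) * s / (- r)) *: pos c X0) +
    (- q) *: (s *: pos c X0 - pos c x)).
  apply: (PconeD hP); rewrite (PconeZ hP) ?oppr_gt0 //; first exact: cone_rel_dominates.
  exact: (pos_lt hP).
rewrite !scalerBr !scalerA [- r * _]mulrC divfK ?gt_eqF // addrA subrK.
by rewrite [(- q) *: h_elt _ _ _ _]scaleNr opprK.
Qed.

Lemma rpow_X0 i : rpow (p i) (X0 : Dyadic) = 1.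
Proof. by rewrite X0E (rpow_int (prime_gt0 (p_prime i)) 0) expr0z. Qed.

(** The sign of an element is that of its value on its leading block: all
    generators of [h] lie in the leading block or in blocks infinitesimal with
    respect to it, the values above the leading block being zero. *)
Lemma cone_lead_gt0 b h : 0 < sg b.1 * bval p h b ->
  (forall c, cone_rel P b c -> bval p h c = 0) -> C h.
Proof.
move=> hb habove; suff Gh : above_value b h.
  by have := Gh 0; rewrite rmorph0 scale0r subr0; apply.
apply: (@h_elt_ind _ (above_value b)) => [||i z x cn0].
- exact: above_value0.
- exact: above_valueD.
rewrite h_elt_pos; have [<-|bc] := eqVneq (i, z) b.
  by apply: above_value_same; rewrite mulf_neq0 // signr_eq0.
have /orP[|bc'] := block_total (cone_rel_order hP) bc; first exact: above_value_below.
by move: cn0; rewrite (bval_coeff p_prime (habove _ bc')) eqxx.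
Qed.

Lemma exists_lead (R : rel (block n)) h : block_order R -> h != 0 ->
  exists2 b, bval p h b != 0 & forall c, R b c -> bval p h c = 0.
Proof.
move=> oR h0; have [s sP] := bval_support p h.
have [b b0] : exists b, bval p h b != 0.
  apply: contrapT => nb; case/eqP: h0; apply: (bval_eq0 p_prime) => b.
  by apply: contrapT => /eqP hb; apply: nb; exists b.
have bs : b \in s by apply: contraNT b0 => /sP ->.
suff [c c0 cmax] : exists2 c, bval p h c != 0 &
    forall d, d \in s -> R c d -> bval p h d = 0.
  by exists c => // d cd; have [ds|/sP//] := boolP (d \in s); exact: cmax.
elim: s b b0 bs {sP} => [//|a s IH] b b0; rewrite inE => /predU1P bs.
have [c c0 cmax] : exists2 c, bval p h c != 0 &
    forall d, d \in s -> R c d -> bval p h d = 0.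
  have [/hasP[d ds d0]|/hasPn s0] := boolP (has (fun d => bval p h d != 0) s).
    exact: IH ds.
  by exists b => // d /s0 /negPn/eqP.
have [a0|a0] := eqVneq (bval p h a) 0.
  by exists c => // d; rewrite inE => /predU1P[->|]; last exact: cmax.
have [ca|nca] := boolP (R c a); last first.
  exists c => // d; rewrite inE => /predU1P[->|]; last exact: cmax.
  by rewrite (negbTE nca).
exists a => // d; rewrite inE => /predU1P[->|ds ad].
  by rewrite (negbTE (block_irr oR a)).
by apply: cmax => //; exact: block_trans oR _ _ _ ca ad.
Qed.

Lemma cone_bounded h : h != 0 -> exists b k, 0 < k /\ C (k *: pos b X0 - h).
Proof.
move=> /(exists_lead (cone_rel_order hP)) [b b0 bmax].
have /dense_ratr [k /andP[]] : Num.max 0 (sg b.1 * bval p h b) <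
    Num.max 0 (sg b.1 * bval p h b) + 1 by rewrite ltrDl.
rewrite gt_max ltr0q => /andP[k0 hk] _; exists b, k; split=> //.
have kE c : bval p (k *: pos b X0 - h) c =
    (if b == c then ratr k * sg b.1 else 0) - bval p h c.
  rewrite bvalB h_eltZ bval_h -surjective_pairing rpow_X0 mulr1 rmorphM /=.
  by rewrite /sgn rmorphXn rmorphN1.
apply: (@cone_lead_gt0 b); first by rewrite kE eqxx mulrBr mulrCA sgnM mulr1 subr_gt0.
move=> c bc; rewrite kE bmax // subr0; case: eqP bc => // <-.
by rewrite (negbTE (block_irr (cone_rel_order hP) b)).
Qed.

End ConeStructure.

(** * Lexicographic orders of [G_n] *)

Lemma same_signD (R : realDomainType) (x y : R) e : x != 0 -> y != 0 ->
  (0 < x) == e -> (0 < y) == e -> (x + y != 0) && ((0 < x + y) == e).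
Proof.
move=> x0 y0 /eqP <- /eqP.
have [x_gt0|x_lt0|x_eq0] := ltgtP 0 x; last by rewrite -x_eq0 eqxx in x0.
  by move=> y_gt0; rewrite gt_eqF addr_gt0.
have [//|y_lt0 _|y_eq0] := ltgtP 0 y; last by rewrite -y_eq0 eqxx in y0.
have xy : x + y < 0 by rewrite -oppr_gt0 opprD addr_gt0 // oppr_gt0.
by rewrite lt_eqF // (lt_gtF xy).
Qed.

Lemma signN (R : realDomainType) (x : R) e : x != 0 ->
  ((0 < - x) == e) = ~~ ((0 < x) == e).
Proof. by rewrite oppr_gt0; case: ltgtP; case: e. Qed.

Lemma mul2z_eq0 a k : (mul2z a k == 0) = (a == 0).
Proof.
apply/eqP/eqP => [/(congr1 dyadic_val)/eqP|->]; last exact: mul20z.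
by rewrite /= mulf_eq0 expfz_eq0 andbF orbF => /eqP E; exact: val_inj.
Qed.

Lemma conj_of_P n (p : 'I_n -> nat) (p_prime : forall i, prime (p i))
    (g : Gn p_prime) (u : Pgrp n) :
  (of_P p_prime u ^ g)%g =
  of_P p_prime (lambda_act p (lambda_part g) (zeta_act (zeta_part g) u)).
Proof.
case: g => b a h; rewrite Gn_normal_form !conjgM conj_zeta_P conj_lambda_P /=.
rewrite ?mul20z ?add0r ?addr0 ?zeta_act0 ?lambda_act0 ?oppr0 ?mul2z0 ?add0r ?addr0.
by rewrite [LHS]conjgE -of_PD [in LHS]addrC of_PD mulKg.
Qed.

Section LexCone.
Context (n : nat) (p : 'I_n -> nat) (p_prime : forall i, prime (p i)).
Context (ez el : bool) (eps : pred 'I_n) (R : rel (block n)).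
Implicit Types (h u v : Pgrp n) (b c : block n).

Definition lead_pos h := exists2 b, 0 < sgn eps b.1 * bval p h b &
  forall c, R b c -> bval p h c = 0.

(** The order with [P_n] infinitesimal with respect to [A], and [P_n ><| A] with
    respect to the powers of [zeta]; [ez] and [el] say whether [zeta] and
    [lambda] are positive. *)
Definition lexcone (g : Gn p_prime) : bool :=
  if zeta_part g != 0 then (0 < zeta_part g) == ez
  else if lambda_part g != 0 then (0 < (lambda_part g : rat)) == el
  else `[< lead_pos (h_part g) >].

Context (oR : block_order R).

Lemma lead_pos0 : ~ lead_pos 0.
Proof. by case=> b; rewrite bval0 mulr0 ltxx. Qed.

Lemma lead_posN h : lead_pos h -> ~ lead_pos (- h).
Proof.
move=> [b b0 bmax] [c]; rewrite bvalN mulrN oppr_gt0 => c0 cmax.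
have [E|bc] := eqVneq b c; first by move: c0; rewrite -E (lt_gtF b0).
have /orP[/bmax E|/cmax/eqP] := block_total oR bc.
  by rewrite E mulr0 ltxx in c0.
by rewrite bvalN oppr_eq0 => /eqP E; rewrite E mulr0 ltxx in b0.
Qed.

Lemma lead_pos_total h : h != 0 -> lead_pos h \/ lead_pos (- h).
Proof.
move=> /(exists_lead p_prime oR) [b b0 bmax].
have : sgn eps b.1 * bval p h b != 0 by rewrite mulf_neq0 // signr_eq0.
rewrite neq_lt => /orP[lt0|gt0]; [right|left]; exists b => //.
  by rewrite bvalN mulrN oppr_gt0.
by move=> c /bmax; rewrite bvalN => ->; rewrite oppr0.
Qed.

Lemma lead_posD u v : lead_pos u -> lead_pos v -> lead_pos (u + v).
Proof.
move=> [b b0 bmax] [c c0 cmax]; have [E|bc] := eqVneq b c.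
  exists b => [|d bd]; first by rewrite bvalD mulrDr addr_gt0 // E.
  by rewrite bvalD bmax // cmax ?addr0 // -E.
have /orP[bc'|cb] := block_total oR bc.
  exists c => [|d cd]; first by rewrite bvalD bmax // add0r.
  by rewrite bvalD cmax // bmax ?addr0 //; exact: block_trans oR _ _ _ bc' cd.
exists b => [|d bd]; first by rewrite bvalD (cmax b) // addr0.
by rewrite bvalD bmax // cmax ?addr0 //; exact: block_trans oR _ _ _ cb bd.
Qed.

Lemma lead_pos_lambda a h : lead_pos h -> lead_pos (lambda_act p a h).
Proof.
case=> -[i z] b0 bmax; exists (i, z) => [|[j w] jw]; rewrite bval_lambda //.
  by rewrite mulrCA mulr_gt0 // rpow_gt0 // prime_gt0.
by rewrite bmax // mulr0.
Qed.

Lemma lead_pos_zeta k h : lead_pos h -> lead_pos (zeta_act k h).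
Proof.
case=> -[i z] b0 bmax; exists (i, z + k) => [|[j w] jw]; rewrite bval_zeta.
  by rewrite addrK.
by apply: bmax; rewrite -(block_shift oR _ _ _ _ k) subrK.
Qed.

Lemma lexcone_cone : positive_cone [set g | lexcone g].
Proof.
split.
- case=> b a h; rewrite /lexcone /=; have [-> /=|b0] := eqVneq b 0; last first.
    rewrite oppr_eq0 b0 signN //.
    by case: ((0 < b) == ez); [constructor 1 | constructor 2].
  rewrite ?oppr0 ?eqxx mul2z0 oppr_eq0 zeta_act_id /=.
  have [-> /=|a0] := eqVneq a 0; last first.
    have a0' : (a : rat) != 0 by [].
    rewrite /= expr0z mulr1 signN //.
    by case: ((0 < _) == el); [constructor 1 | constructor 2].
  rewrite ?oppr0 lambda_act_id.
  have [->|/lead_pos_total [h1|h1]] := eqVneq h 0; first by constructor 3.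
    by constructor 1; apply/asboolP.
  by constructor 2; apply/asboolP.
- case=> b a h; rewrite /lexcone /=; have [-> /=|b0] := eqVneq b 0; last first.
    by rewrite oppr_eq0 b0 signN //= => ->.
  rewrite ?oppr0 ?eqxx mul2z0 oppr_eq0 zeta_act_id /=.
  have [-> /=|a0] := eqVneq a 0; last first.
    have a0' : (a : rat) != 0 by [].
    by rewrite /= expr0z mulr1 signN // => ->.
  by rewrite ?oppr0 lambda_act_id => /asboolP/lead_posN h1 /asboolP.
- by rewrite /lexcone /= ?eqxx /= => /asboolP/lead_pos0.
- case=> b a h [b' a' h']; rewrite /lexcone /=.
  have [-> /=|b0] := eqVneq b 0; have [-> /=|b0'] := eqVneq b' 0;
    rewrite ?addr0 ?add0r ?eqxx ?b0 ?b0' //=; last first.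
    by move=> bz bz'; have /andP[-> ->] := same_signD b0 b0' bz bz'.
  rewrite oppr0 mul2z0 zeta_act_id.
  have [-> /=|a0] := eqVneq a 0; have [-> /=|a0'] := eqVneq a' 0;
    rewrite ?addr0 ?add0r ?eqxx ?a0 ?a0' //=; last first.
    move=> az az'; have a1 : (a : rat) != 0 by [].
    have a1' : (a' : rat) != 0 by [].
    rewrite expr0z mulr1; have /andP[aa ->] := same_signD a1 a1' az az'.
    by have -> : a + a' != 0 by exact: aa.
    by rewrite expr0z mulr1.
  rewrite lambda_act_id => /asboolP h1 /asboolP h2; apply/asboolP; exact: lead_posD.
- move=> g u lu; change (lexcone (g * u * g^-1)%g).
  have zE : zeta_part (g * u * g^-1)%g = zeta_part u by rewrite /= addrAC subrr add0r.
  have aE : zeta_part u = 0 ->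
      lambda_part (g * u * g^-1)%g = mul2z (lambda_part u) (zeta_part g).
    by move=> u0; rewrite /= u0 oppr0 mul2z0 mul2zD opprK addrAC subrr add0r.
  have hE : zeta_part u = 0 -> lambda_part u = 0 -> h_part (g * u * g^-1)%g =
      lambda_act p (lambda_part g^-1%g) (zeta_act (zeta_part g^-1%g) (h_part u)).
    case: u {lu zE aE} => b a h /= -> ->.
    by have := conj_of_P g^-1%g h; rewrite conjgE invgK mulgA => /(congr1 (@h_part _ _ _)).
  move: (g * u * g^-1)%g zE aE hE lu => g' zE aE hE.
  rewrite /= /lexcone zE; case: eqVneq => //= u0; rewrite aE //.
  rewrite mul2z_eq0.
  case: eqVneq => /= [a0|_]; last by rewrite pmulr_lgt0 // exprz_gt0.
  rewrite hE // => /asboolP h1; apply/asboolP.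
  exact/lead_pos_lambda/lead_pos_zeta.
Qed.

End LexCone.

(** * Every order of [G_n] is lexicographic *)

Section ConeIsLex.
Context (n : nat) (p : 'I_n -> nat) (p_prime : forall i, prime (p i)).
Context (p_inj : injective p).
Context (P : Gn p_prime -> bool) (hP : positive_cone [set g | P g]).
Implicit Types (h u v : Pgrp n) (a e : Dyadic) (b c : block n).

Local Notation C h := (P (of_P p_prime h)).
Local Notation L a := (lambda p_prime a).
Local Notation Z k := (zeta p_prime k).
Local Notation pos := (pos_gen P).

Lemma of_P_expg h m : (of_P p_prime h ^+ m)%g = of_P p_prime (m%:R *: h).
Proof.
elim: m => [|m IH]; first by rewrite scale0r.
by rewrite expgS IH -of_PD -[m.+1]add1n natrD scalerDl scale1r.
Qed.

Lemma lambda_expg a m : (L a ^+ m)%g = L (a *+ m).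
Proof. by elim: m => [|m IH] //; rewrite expgS IH -lambdaD mulrS. Qed.

Lemma zeta_expg k m : (Z k ^+ m)%g = Z (k *+ m).
Proof. by elim: m => [|m IH] //; rewrite expgS IH -zetaD mulrS. Qed.

Lemma lambdaN a : L (- a) = (L a)^-1%g.
Proof. by apply: (@mulgI _ (L a)); rewrite mulgV -lambdaD subrr. Qed.

Lemma zetaN k : Z (- k) = (Z k)^-1%g.
Proof. by apply: (@mulgI _ (Z k)); rewrite mulgV -zetaD subrr. Qed.

Lemma cone_mulC (g f : Gn p_prime) : P (g * f)%g -> P (f * g)%g.
Proof. by move=> /(cone_conj hP f); rewrite /= mulgA mulgK. Qed.

Lemma cone_mulb (g f : Gn p_prime) : P g -> P f -> P (g * f)%g.
Proof. exact: (cone_mul hP). Qed.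

Lemma cone_totalb (g : Gn p_prime) : g <> 1%g -> ~~ P g -> P g^-1%g.
Proof. by move=> g1 /negP nP; exact: (cone_total hP). Qed.

Lemma dyadic_mul_int a (z : int) : exists (m : nat) (M : int),
  ((a *+ m.+1 : Dyadic) : rat) * 2 ^ z = M%:~R.
Proof.
have [M [k aE]] := dyadicPn (valP a).
exists (2 ^ (k + absz z)).-1%N, (M * 2 ^+ absz (Posz (absz z) + z)%R).
rewrite prednK ?expn_gt0 // dyadic_valMn aE -[_ *+ _]mulr_natr natrX.
rewrite rmorphM rmorphXn /= exprD -!mulrA; congr (_ * _).
rewrite mulKf ?expf_neq0 // !exprnP -expfzDr //; congr (_ ^ _); lia.
Qed.

(** Every [h] is below a multiple of the generator of its leading block, and a power
    of [lambda^a] acts on that block as multiplication by a nontrivial integral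
    power of [p_i], so that [cone_lt_conj] applies. *)
Lemma lambda_above_P a h : a != 0 -> P (L a) -> C h ->
  P ((of_P p_prime h)^-1 * L a)%g.
Proof.
move=> a0 Pa Ch; apply: contrapT => /negP nP.
have h0 : h != 0 by apply: contraTneq Ch => ->; rewrite (Pcone0 hP).
have lh : P ((L a)^-1 * of_P p_prime h)%g.
  rewrite -[X in (_ * X)%g]invgK -invgM.
  apply: cone_totalb => // /(congr1 (@lambda_part _ _ _)) /=.
  by rewrite oppr0 ?mul2z0 ?mul20z ?oppr0 add0r => /eqP; rewrite (negbTE a0).
have [[i z] [k [k0 hk]]] := cone_bounded p_inj hP h0.
have [m [M ME]] := dyadic_mul_int a z.
have M0 : M != 0.
  apply: contra_neq a0 => M0; apply: val_inj; move: ME; rewrite M0 dyadic_valMn => /eqP.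
  by rewrite mulf_eq0 expfz_eq0 andbF orbF mulrn_eq0 => /eqP.
pose kk := m.+1%:R *: (k *: pos (i, z) X0).
have kkE : kk = h_elt i (m.+1%:R * (k * sgn (cone_eps P) i)) z X0 by rewrite /kk !h_eltZ.
have Ckk : C kk by rewrite /kk !(PconeZ hP) ?ltr0n //; exact: (Pcone_pos hP).
(* If [lambda^a < h], then [(lambda^a)^(m+1) < h^(m+1) < kk < (lambda^a)^(m+1)]. *)
have gk : P ((of_P p_prime kk)^-1 * (L a ^+ m.+1))%g.
  apply: (cone_lt_conj hP (m := p i ^ `|M|)) => //.
  - exact: (cone_expg hP).
  - by rewrite -(exp1n `|M|) ltn_exp2r ?absz_gt0 // prime_gt1.
  rewrite lambda_expg -lambdaN !conj_lambda_P of_P_expg kkE.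
  have ME' : ((- (a *+ m.+1) : Dyadic) : rat) * 2 ^ z = (- M)%:~R.
    by rewrite intrN -ME /= mulNr.
  rewrite (lambda_act_int _ _ _ ME) (lambda_act_int _ _ _ ME') natrX.
  by case: M {ME M0 ME'} => M; [left | right; rewrite NegzE opprK].
have hk' : P ((of_P p_prime h ^+ m.+1)^-1 * of_P p_prime kk)%g.
  by rewrite of_P_expg -(of_PN p_prime) -of_PD addrC -scalerBr (PconeZ hP) ?ltr0n.
have := cone_mulb (cone_lt_expg hP m lh) hk'.
rewrite mulgA mulgK => /(cone_not_inv hP) [].
by rewrite /= invgM invgK.
Qed.

Lemma lambda_pos_P a h : a != 0 -> P (L a) -> P (L a * of_P p_prime h)%g.
Proof.
move=> a0 Pa; have [->|h0] := eqVneq h 0; first by rewrite mulg1.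
have [Ch|/(Pcone_total hP h0) Ch] := boolP (C h); first exact: cone_mulb.
have := lambda_above_P a0 Pa Ch; rewrite of_PN invgK; exact: cone_mulC.
Qed.

(** Conjugation by [zeta^-k] or [zeta^k] raises [lambda^e] to the power [2^|k|]. *)
Lemma zeta_above_lambda (k : int) e : k != 0 -> P (Z k) -> P (L e) ->
  P ((L e)^-1 * Z k)%g.
Proof.
move=> k0 Pk Pe; apply: (cone_lt_conj hP (m := 2 ^ `|k|)) => //.
  by apply: leq_ltn_trans (ltn_expl _ _); rewrite ?absz_gt0.
rewrite -zetaN !conj_zeta_lambda lambda_expg opprK.
have E (j : nat) : mul2z e j = e *+ 2 ^ j.
  by apply: val_inj; rewrite [RHS]dyadic_valMn /= -[RHS]mulr_natr natrX.
by case: k {k0 Pk} => k; [right; rewrite E | left; rewrite NegzE opprK E].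
Qed.

Lemma lambda_total a : a != 0 -> ~~ P (L a) -> P (L (- a)).
Proof.
move=> a0 nP; rewrite lambdaN; apply: cone_totalb => //.
by move=> /(congr1 (@lambda_part _ _ _)) /= /eqP; rewrite (negbTE a0).
Qed.

(** The element [lambda^a h] exceeds some negative power of [lambda], which in turn
    exceeds [zeta^-k]. *)
Lemma zeta_pos_M (k : int) a h : k != 0 -> P (Z k) ->
  P (Z k * (L a * of_P p_prime h))%g.
Proof.
move=> k0 Pk; have [e [Pe ea0 Pea]] : exists e, [/\ P (L e), e + a != 0 & P (L (e + a))].
  have [->|a0] := eqVneq a 0.
    have o0 : int_dyadic 1 != 0 by [].
    have [Po|/(lambda_total o0) Po] := boolP (P (L (int_dyadic 1))).
      by exists (int_dyadic 1); rewrite addr0.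
    by exists (- int_dyadic 1); rewrite addr0 oppr_eq0.
  have [Pa|/(lambda_total a0) Pa] := boolP (P (L a)).
    exists a; split=> //; last by rewrite lambdaD; exact: cone_mulb.
    apply: contra_neq a0 => aa; apply: val_inj; move: (congr1 dyadic_val aa) => /= /eqP.
    by rewrite -mulr2n mulrn_eq0 => /eqP.
  exists (- a - a); rewrite subrK; split=> //; last by rewrite oppr_eq0.
  by rewrite lambdaD; exact: cone_mulb.
have Pu : P (L e * (L a * of_P p_prime h))%g.
  by rewrite mulgA -lambdaD; exact: lambda_pos_P.
have := cone_mulb (cone_mulC (zeta_above_lambda k0 Pk Pe)) Pu.
by rewrite mulgA mulgVK.
Qed.

(** A positive power of [lambda^a] is a power of [lambda] or of its inverse. *)
Lemma lambda_sign a : a != 0 -> (0 < (a : rat)) == P (L (int_dyadic 1)) -> P (L a).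
Proof.
move=> a0 aP; have [m [M]] := dyadic_mul_int a 0; rewrite expr0z mulr1 => ME.
have aM : (L a ^+ m.+1)%g = L (int_dyadic M).
  by rewrite lambda_expg; congr (lambda _ _); exact: val_inj.
have LM (s : int) (k : nat) : (L (int_dyadic s) ^+ k)%g = L (int_dyadic (s * k)).
  rewrite lambda_expg; congr (lambda _ _); apply: val_inj.
  by rewrite [LHS]dyadic_valMn /= -[LHS]mulr_natr rmorphM.
have o0 : int_dyadic 1 != 0 by [].
have aV : (a : rat) != 0 by rewrite (inj_eq val_inj _ 0).
have aS : Num.sg (a : rat) = Num.sg M%:~R.
  rewrite -ME dyadic_valMn -[_ *+ _]mulr_natr sgrM.
  by rewrite [X in _ = _ * X]gtr0_sg ?mulr1 ?ltr0n.
suff [s [k]] : exists (s : int) k, P (L (int_dyadic s)) /\ M = s * k.+1.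
  case=> Ps Mk; apply: (@cone_expgI _ _ hP (L a) m); rewrite /= aM Mk -LM.
  exact: (cone_expg hP).
have [] := ltgtP 0 (a : rat); last by move=> a0'; rewrite -a0' eqxx in aV.
  move=> a_gt0; rewrite a_gt0 in aP; exists 1, `|M|.-1.
  rewrite gtr0_sg // in aS; have M0 : 0 < M by rewrite -(ltr0z rat) -sgr_gt0 -aS.
  split; first by rewrite -(eqP aP).
  rewrite prednK ?absz_gt0 ?gt_eqF //; lia.
move=> a_lt0; rewrite (lt_gtF a_lt0) in aP; exists (-1), `|M|.-1.
rewrite ltr0_sg // in aS; have M0 : M < 0 by rewrite -(ltrz0 rat) -sgr_lt0 -aS.
split; last by rewrite prednK ?absz_gt0 ?lt_eqF //; lia.
have -> : int_dyadic (-1) = - int_dyadic 1 by exact: val_inj.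
by apply: lambda_total o0 _; rewrite -(eqP aP).
Qed.

Lemma zeta_sign (k : int) : k != 0 -> (0 < k) == P (Z 1) -> P (Z k).
Proof.
case: k => [[|k]|k] // _ /eqP/esym Pk.
  by have := cone_expg hP k Pk; rewrite /= zeta_expg natz.
have nP : P (Z 1)^-1%g by apply: cone_totalb; [case | rewrite Pk].
have := cone_expg hP k nP; rewrite /= -zetaN zeta_expg NegzE.
by rewrite mulNrn natz.
Qed.

Lemma lexcone_sub g : lexcone (P (Z 1)) (P (L (int_dyadic 1))) (cone_eps P) (cone_rel P) g ->
  P g.
Proof.
case: g => b a h; rewrite /lexcone /=; have [->|b0] := eqVneq b 0; last first.
  by move=> /(zeta_sign b0) Pz; rewrite Gn_normal_form -mulgA; exact: zeta_pos_M.
have [->|a0] := eqVneq a 0; last first.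
  by move=> /(lambda_sign a0) Pl; rewrite Gn_normal_form mul1g; exact: lambda_pos_P.
by move=> /asboolP [c c0 cmax]; exact: cone_lead_gt0 c0 cmax.
Qed.

(** Both sides are positive cones, so the inclusion [lexcone_sub] is an equality. *)
Lemma cone_lexE g :
  P g = lexcone (P (Z 1)) (P (L (int_dyadic 1))) (cone_eps P) (cone_rel P) g.
Proof.
apply/idP/idP; last exact: lexcone_sub.
have hL := lexcone_cone p_prime (P (Z 1)) (P (L (int_dyadic 1))) (cone_eps P)
  (cone_rel_order hP).
move=> Pg; case: (cone_cover hL g) => [//|/lexcone_sub/(cone_not_inv hP)|g1].
  by rewrite /= invgK.
by case: (cone_not1 hP); rewrite -g1.
Qed.

End ConeIsLex.

(** * Interleaving of chains in a shift-invariant order *)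

Section Interleaving.
Context (n : nat).
Implicit Types (R : rel (block n)) (i j k : 'I_n) (z w : int).

(** The chain of [i] has elements on both sides of [(j, 0)], hence of every
    [(j, w)]. *)
Definition linked R i j : bool :=
  `[< (exists z, R (j, 0) (i, z)) /\ (exists z, R (i, z) (j, 0)) >].

(** The least index of each interleaving class; counting these representatives
    counts the classes. *)
Definition heads R : {set 'I_n} :=
  [set i : 'I_n | [forall j : 'I_n, (j < i)%N ==> ~~ linked R i j]].

Section OneOrder.
Context (R : rel (block n)) (oR : block_order R).

Lemma block_shift0 i j z w : R (i, z) (j, w) = R (i, 0) (j, w - z).
Proof. by rewrite -[RHS](block_shift oR _ _ _ _ z) add0r subrK. Qed.

Lemma block_asym b c : b != c -> R c b = ~~ R b c.
Proof.
move=> bc; have /orP[H|H] := block_total oR bc; rewrite H.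
  apply: negbTE; apply/negP => H'; have := block_trans oR H H'.
  by rewrite (negbTE (block_irr oR b)).
by apply/esym/negP => H'; have := block_trans oR H H'; rewrite (negbTE (block_irr oR c)).
Qed.

Lemma chain_up i z w : R (i, 0) (i, 1) -> z < w -> R (i, z) (i, w).
Proof.
move=> up zw; rewrite block_shift0; have [k ->] : exists k : nat, w - z = k.+1.
  by exists (absz (w - z)).-1; lia.
elim: k => [//|k IH]; apply: block_trans oR _ _ _ IH _.
by rewrite block_shift0 (_ : _ - _ = 1) //; lia.
Qed.

Lemma chain_down i z w : ~~ R (i, 0) (i, 1) -> z < w -> R (i, w) (i, z).
Proof.
rewrite -block_asym ?xpair_eqE ?eqxx // => down zw.
rewrite block_shift0; have [k ->] : exists k : nat, z - w = - (k.+1%:Z).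
  by exists (absz (z - w)).-1; lia.
elim: k => [|k IH].
  by move: down; rewrite block_shift0.
apply: block_trans oR _ _ _ IH _.
rewrite block_shift0 in down; rewrite block_shift0 (_ : _ - (- _) = 0 - 1) //; lia.
Qed.

Lemma linked_refl i : linked R i i.
Proof.
apply/asboolP; have [up|down] := boolP (R (i, 0) (i, 1)).
  by split; [exists 1 | exists (- 1)]; apply: chain_up up _.
by split; [exists (- 1) | exists 1]; apply: chain_down down _.
Qed.

Lemma linked_sym i j : linked R i j -> linked R j i.
Proof.
move=> /asboolP [[z jz] [w wj]]; apply/asboolP; split.
  by exists (- w); rewrite -(block_shift oR _ _ _ _ w) add0r addNr.
by exists (- z); rewrite -(block_shift oR _ _ _ _ z) add0r addNr.
Qed.

Lemma linked_trans i j k : linked R i j -> linked R j k -> linked R i k.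
Proof.
move=> /asboolP [[z jz] [w wj]] /asboolP [[z' kz'] [w' w'k]].
apply/asboolP; split.
  exists (z + z'); apply: block_trans oR _ _ _ kz' _.
  by rewrite -(block_shift oR _ _ _ _ z') add0r in jz.
exists (w + w'); apply: block_trans oR _ _ _ _ w'k.
by rewrite -(block_shift oR _ _ _ _ w') add0r in wj.
Qed.

(** Unlinked chains lie on one side of each other, so one comparison decides. *)
Lemma unlinked_const i j z : ~~ linked R i j -> R (j, 0) (i, z) = R (j, 0) (i, 0).
Proof.
move=> nl; have ij : i != j by apply: contraNneq nl => ->; exact: linked_refl.
have ne w : (j, 0 : int) != (i, w) by rewrite xpair_eqE eq_sym (negbTE ij).
have [[w0 jw]|njw] := pselect (exists w, R (j, 0) (i, w)); last first.
  by apply/idP/idP => H; case: njw; [exists z | exists 0].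
suff all w : R (j, 0) (i, w) by rewrite !all.
move: nl; rewrite -[R _ _]negbK -block_asym //; apply: contraNN => wj.
by apply/asboolP; split; [exists w0 | exists w].
Qed.

Lemma exists_head i : exists2 j, j \in heads R & linked R i j.
Proof.
case: (arg_minnP (P := linked R i) (fun j => nat_of_ord j) (linked_refl i)) => j ij jmin.
exists j => //; rewrite inE; apply/forallP => k; apply/implyP => kj.
apply/negP => jk; have := jmin k (linked_trans ij jk); lia.
Qed.

End OneOrder.

(** [K] bounds witnesses of all interleavings.  Agreement within [K] forces linked
    indices of [R] to be linked in [R'], so [R'] has at most as many classes.  If
    it has as many, the classes are the same; then comparisons at distance
    beyond [K] follow from those within [K], by monotonicity of a chain in the
    linked case and by [unlinked_const] otherwise. *)
Lemma block_order_rigid R : block_order R -> exists K : nat,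
  forall R', block_order R' ->
    (forall i j z, `|z| <= K%:Z -> R' (j, 0) (i, z) = R (j, 0) (i, z)) ->
  R' =2 R \/ (#|heads R'| < #|heads R|)%N.
Proof.
move=> oR.
have /boolp.choice [Kf KfP] : forall ij : 'I_n * 'I_n, exists k : nat, linked R ij.1 ij.2 ->
    (exists2 z, `|z| <= k%:Z & R (ij.2, 0) (ij.1, z)) /\
    (exists2 z, `|z| <= k%:Z & R (ij.1, z) (ij.2, 0)).
  case=> i j /=; have [/asboolP [[z jz] [w wj]]|_] := boolP (linked R i j); last by exists 0%N.
  by exists (`|z| + `|w|)%N => _; split; [exists z | exists w] => //; lia.
have [K K1 KP] : exists2 K : nat, (0 < K)%N & forall i j, linked R i j ->
    (exists2 z, `|z| <= K%:Z & R (j, 0) (i, z)) /\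
    (exists2 z, `|z| <= K%:Z & R (i, z) (j, 0)).
  exists (\max_ij Kf ij).+1 => // i j /(KfP (i, j)) /= [[z zK jz] [w wK wj]].
  have := leq_bigmax (F := Kf) (i, j); move: (\max_ij _) => K leK.
  by split; [exists z | exists w] => //; lia.
exists K => R' oR' agree.
have agree' i j z : `|z| <= K%:Z -> R' (i, z) (j, 0) = R (i, z) (j, 0).
  move=> zK; have [E|ne] := eqVneq (j, 0 : int) (i, z).
    by rewrite E (negbTE (block_irr oR _)) (negbTE (block_irr oR' _)).
  by rewrite (block_asym oR ne) (block_asym oR' ne) agree.
have sub i j : linked R i j -> linked R' i j.
  move=> /KP [[z zK jz] [w wK wj]]; apply/asboolP.
  by split; [exists z; rewrite agree | exists w; rewrite agree'].
have subh : heads R' \subset heads R.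
  apply/fintype.subsetP => i; rewrite !inE => /forallP hi; apply/forallP => j.
  by apply/implyP => /(implyP (hi j)); exact/contraNN/sub.
have [le|] := leqP #|heads R| #|heads R'|; last by right.
have eqh : heads R' = heads R by apply/eqP; rewrite eqEcard subh.
left.
have eql i j : linked R' i j = linked R i j.
  apply/idP/idP => [lij|]; last exact: sub.
  have [i0 hi0 ii0] := exists_head oR i; have [j0 hj0 jj0] := exists_head oR j.
  have l0 : linked R' i0 j0.
    apply: (linked_trans oR') (sub _ _ jj0); apply: (linked_trans oR') lij.
    exact/(linked_sym oR')/sub.
  (* If [i0] and [j0] differed, the larger one would not be a head of [R']. *)
  have E : i0 = j0.
    apply: val_inj; apply/eqP; rewrite eqn_leq; rewrite -eqh in hi0 hj0.
    apply/andP; split; rewrite leqNgt; apply/negP => lt.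
      move: hi0; rewrite inE => /forallP/(_ j0)/implyP/(_ lt).
      by rewrite l0.
    move: hj0; rewrite inE => /forallP/(_ i0)/implyP/(_ lt).
    by rewrite (linked_sym oR' l0).
  apply: (linked_trans oR ii0); rewrite E; exact: (linked_sym oR).
suff H i j z : R' (j, 0) (i, z) = R (j, 0) (i, z).
  by move=> [i z] [j w]; rewrite (block_shift0 oR) (block_shift0 oR') H.
have [zK|zK] := leP `|z| K%:Z; first exact: agree.
have [lij|nl] := boolP (linked R i j); last first.
  by rewrite (unlinked_const oR) // (unlinked_const oR') ?eql // agree.
have [[z1 z1K jz1] [z2 z2K z2j]] := KP _ _ lij.
have jz1' : R' (j, 0) (i, z1) by rewrite agree.
have z2j' : R' (i, z2) (j, 0) by rewrite agree'.
have dir : R' (i, 0) (i, 1) = R (i, 0) (i, 1) by rewrite agree.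
have above R0 : block_order R0 -> R0 (i, z1) (i, z) -> R0 (j, 0) (i, z1) ->
    R0 (j, 0) (i, z).
  by move=> o0 H1 H2; exact: block_trans o0 _ _ _ H2 H1.
have below R0 : block_order R0 -> R0 (i, z) (i, z2) -> R0 (i, z2) (j, 0) ->
    R0 (j, 0) (i, z) = false.
  move=> o0 H1 H2; apply/negP => H3.
  have := block_trans o0 (block_trans o0 H1 H2) H3.
  by rewrite (negbTE (block_irr o0 _)).
have [up|down] := boolP (R (i, 0) (i, 1)); have [zpos|zneg] := ltP 0 z.
- by rewrite !above //; apply: chain_up; rewrite ?dir //; lia.
- by rewrite !below //; apply: chain_up; rewrite ?dir //; lia.
- by rewrite !below //; apply: chain_down; rewrite ?dir //; lia.
- by rewrite !above //; apply: chain_down; rewrite ?dir //; lia.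
Qed.

End Interleaving.

(** * Isolated points of spaces of subsets *)

Local Open Scope classical_set_scope.

Lemma nbhs_agree (G : eqType) (f : {ptws G -> bool}) (s : seq G) :
  nbhs f [set f' : {ptws G -> bool} | {in s, f' =1 f}].
Proof.
elim: s => [|g s IH]; first by apply: filterS filterT.
have /= Hg : nbhs f [set f' : {ptws G -> bool} | f' g = f g].
  have := @proj_continuous G (fun=> bool) g f [set f g].
  by apply; apply: discrete_set1.
apply: filterS (filterI Hg IH) => f' [f'g f's] x.
by rewrite inE => /predU1P[->|/f's].
Qed.

Lemma cvg_pointwise_eventually (G : eqType) (u : nat -> {ptws G -> bool})
    (f : {ptws G -> bool}) :
  (forall g, exists M, forall N, (M <= N)%N -> u N g = f g) -> u @ \oo --> f.
Proof.
move=> H; apply/cvg_sup => g U [B [[W oW <-] Bf] BU].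
have [M HM] := H g; apply: (@filterS _ (\oo) _ [set N | (M <= N)%N]).
  by move=> N /= /HM E; apply: BU; rewrite /= E.
by exists M.
Qed.

(** Among the points of rank above [k], those of rank [k + 1] are isolated, since
    their other neighbours have rank at most [k]. *)
Lemma iter_derived_rank (T : topologicalType) (Y : set T) (r : T -> nat) :
  (forall x, Y x -> (0 < r x)%N) ->
  (forall x, Y x -> \forall y \near x, Y y -> y = x \/ (r y < r x)%N) ->
  forall k, iter k (@derived T) Y `<=` [set x | Y x /\ (k < r x)%N].
Proof.
move=> r0 rlow; elim=> [|k IH] x /=; first by move=> Yx; split=> //; exact: r0.
move=> [Ex nx]; have [Yx kr] := IH x Ex; split=> //.
rewrite ltn_neqAle kr andbT; apply/negP => /eqP rk; apply: nx.
split; first exact/mem_set.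
exists [set y | Y y -> y = x \/ (r y < r x)%N]; first exact: rlow.
apply/seteqP; split=> [y [/= Hy Ey]|y ->] /=.
  have [Yy kry] := IH y Ey; have [//|] := Hy Yy.
  by rewrite -rk ltnS leqNgt kry.
by split=> //; left.
Qed.

Lemma sub_iter_derived (T : topologicalType) (Y : set T) (F : nat -> set T) :
  F 0%N `<=` Y ->
  (forall k x, F k.+1 x -> F k x /\
    exists u : nat -> T, u @ \oo --> x /\ forall N, F k (u N) /\ u N <> x) ->
  forall k, F k `<=` iter k (@derived T) Y.
Proof.
move=> F0 FS; elim=> [|k IH] x; first exact: F0.
move=> /FS [Fx [u [ux uF]]] /=.
split; first exact: IH.
move=> [_ [V Vx VE]]; have [M _ MV] := ux V Vx.
have [FM uMx] := uF M; apply: uMx.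
have : (V `&` iter k (@derived T) Y) (u M) by split; [exact: MV (leqnn M) | exact: IH].
by rewrite VE.
Qed.

(** * The number of interleaving classes bounds the derivatives *)

Section UpperBound.
Context (n : nat) (p : 'I_n -> nat) (p_prime : forall i, prime (p i)).
Context (p_inj : injective p).
Local Notation Y := (space_of_orders (Gn p_prime)).

Definition nheads (P : Gn p_prime -> bool) := #|heads (cone_rel P)|.

Lemma nheads_le P : (nheads P <= n)%N.
Proof. by rewrite -[X in (_ <= X)%N](card_ord n) max_card. Qed.

Lemma nheads_gt0 P : (0 < n)%N -> Y P -> (0 < nheads P)%N.
Proof.
move=> n0 hP; apply/card_gt0P; exists (Ordinal n0); rewrite inE.
by apply/forallP => j; apply/implyP.
Qed.

(** The signs and the comparisons within the bound [K] of [block_order_rigid] are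
    the signs of finitely many group elements. *)
Lemma nheads_near P : Y P -> \forall Q \near P, Y Q -> Q = P \/ (nheads Q < nheads P)%N.
Proof.
move=> hP; have [K HK] := block_order_rigid (cone_rel_order hP).
pose diff (t : 'I_n * 'I_n * 'I_(2 * K).+1) : Gn p_prime :=
  of_P p_prime (pos_gen P (t.1.1, (t.2 : int) - K%:Z) X0 - pos_gen P (t.1.2, 0) X0).
pose s := [:: zeta p_prime 1; lambda p_prime (int_dyadic 1)] ++
  [seq of_P p_prime (h_elt i 1 0 X0) | i <- enum 'I_n] ++
  [seq diff t | t <- enum {: 'I_n * 'I_n * 'I_(2 * K).+1}].
apply: filterS (nbhs_agree P s) => Q /= agree hQ.
have epsE : cone_eps Q = cone_eps P.
  apply/funext => i; rewrite /cone_eps agree // /s !mem_cat.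
  by rewrite (map_f (fun i => of_P p_prime (h_elt i 1 0 X0))) ?orbT // mem_enum.
have [|relE|] := HK _ (cone_rel_order hQ); last by right.
  move=> i j z zK; have [m ->] : exists m : 'I_(2 * K).+1, z = (m : int) - K%:Z.
    have zb : (absz (z + K%:Z)%R < (2 * K).+1)%N by lia.
    by exists (Ordinal zb) => /=; lia.
  have ds : diff (i, j, m) \in s by rewrite /s !mem_cat map_f ?orbT // mem_enum.
  by have := agree _ ds; rewrite /diff /cone_rel /pos_gen epsE.
left; apply/funext => g; rewrite (cone_lexE p_inj hP) (cone_lexE p_inj hQ) epsE.
have -> : cone_rel Q = cone_rel P by apply/funext => b; apply/funext => c; exact: relE.
by rewrite !agree // !inE eqxx ?orbT.
Qed.

End UpperBound.

(** * Orders surviving many derivatives *)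

Section LowerBound.
Context (n : nat) (p : 'I_n -> nat) (p_prime : forall i, prime (p i)).
Implicit Types (t : nat) (o : 'I_n -> int) (b c : block n) (R : rel (block n)).

(** Increasing chains, of which those of index at most [t] are interleaved with
    offsets [o] and the others dominate each other in the order of their indices:
    the block [(i, z)] is ranked lexicographically by [max i t], [z + o i], [i]. *)
Definition merged_rel t o : rel (block n) := fun b c =>
  (maxn b.1 t < maxn c.1 t)%N || (maxn b.1 t == maxn c.1 t) &&
  ((b.2 + o b.1 < c.2 + o c.1) || (b.2 + o b.1 == c.2 + o c.1) && (b.1 < c.1)%N).

Lemma merged_rel_order t o : block_order (merged_rel t o).
Proof.
split; rewrite /merged_rel.
- by move=> [i z] /=; lia.
- by move=> [i z] [j w] [k v] /=; lia.
- move=> [i z] [j w]; rewrite xpair_eqE /=; have [->|ij] := eqVneq i j; first lia.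
  have {}ij : i <> j :> nat by move/val_inj=> E; rewrite E eqxx in ij.
  lia.
- by move=> i j z w k /=; lia.
Qed.

Lemma lead_pos_diff R b c : block_order R -> R b c ->
  lead_pos p pred0 R (h_elt c.1 1 c.2 X0 - h_elt b.1 1 b.2 X0).
Proof.
move=> oR bc; have ne : (b == c) = false.
  by apply/eqP => E; move: bc; rewrite E (negbTE (block_irr oR c)).
exists c => [|d cd]; rewrite bvalB !bval_h -!surjective_pairing ?eqxx ?ne.
  by rewrite /sgn expr0 mul1r rmorph1 mul1r subr0 rpow_gt0 // prime_gt0.
rewrite !ifN ?subr0 //; last by apply: contraTneq cd => <-; exact: block_irr oR c.
apply: contraTneq cd => <-; apply/negP => cb; have := block_trans oR bc cb.
by rewrite (negbTE (block_irr oR b)).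
Qed.

(** Only the finitely many blocks in the support of [h] matter. *)
Lemma lead_pos_agree R R' (s : seq (block n)) h :
  (forall b, b \notin s -> bval p h b = 0) ->
  {in s &, forall b c, R b c = R' b c} -> lead_pos p pred0 R h -> lead_pos p pred0 R' h.
Proof.
move=> hs RR' [b b0 bmax]; exists b => // c bc.
have [cs|/hs//] := boolP (c \in s); apply: bmax; rewrite RR' //.
by apply: contraTT b0 => /hs ->; rewrite mulr0 ltxx.
Qed.

Definition merged_cone t o : {ptws Gn p_prime -> bool} :=
  lexcone (p_prime := p_prime) true true pred0 (merged_rel t o).

Lemma merged_cone_order t o : space_of_orders (Gn p_prime) (merged_cone t o).
Proof. exact: lexcone_cone (merged_rel_order t o). Qed.

Lemma eventually_all (T : eqType) (Q : T -> nat -> Prop) (s : seq T) :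
  (forall x, exists M, forall N, (M <= N)%N -> Q x N) ->
  exists M, forall N, (M <= N)%N -> {in s, forall x, Q x N}.
Proof.
move=> H; elim: s => [|x s [M HM]]; first by exists 0%N.
have [M' HM'] := H x; exists (maxn M M') => N; rewrite geq_max => /andP[le le'] y.
by rewrite inE => /predU1P[->|ys]; [exact: HM' | exact: HM].
Qed.

Section Shift.
Context (t : nat) (tn : (t.+1 < n)%N) (o : 'I_n -> int).

(** The chain [t + 1] is interleaved with the previous ones at an offset [N] which
    tends to infinity; in the limit it dominates them. *)
Definition shifted (N : nat) : 'I_n -> int :=
  fun i => if i == t.+1 :> nat then N%:Z else o i.

Lemma merged_rel_shifted b c : exists M, forall N, (M <= N)%N ->
  merged_rel t.+1 (shifted N) b c = merged_rel t o b c.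
Proof.
case: b c => [i z] [j w]; exists (absz (w + o j - z)%R + absz (z + o i - w)%R).+1 => N le.
rewrite /merged_rel /shifted /=; have [->|ij] := eqVneq i j.
  by case: (nat_of_ord j =P t.+1); lia.
have {}ij : i <> j :> nat by move/val_inj=> E; rewrite E eqxx in ij.
by case: (nat_of_ord i =P t.+1) => it; case: (nat_of_ord j =P t.+1) => jt; lia.
Qed.

Lemma cvg_shifted : (fun N => merged_cone t.+1 (shifted N)) @ \oo --> merged_cone t o.
Proof.
apply: cvg_pointwise_eventually => g; have [s sP] := bval_support p (h_part g).
have [M HM] := @eventually_all _
  (fun bc N => merged_rel t.+1 (shifted N) bc.1 bc.2 = merged_rel t o bc.1 bc.2)
  [seq (b, c) | b <- s, c <- s] (fun bc => merged_rel_shifted bc.1 bc.2).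
exists M => N /HM agree; rewrite /merged_cone /lexcone; do 2![case: ifP => // _].
have ag : {in s &, forall b c, merged_rel t.+1 (shifted N) b c = merged_rel t o b c}.
  by move=> b c bs cs; apply: (agree (b, c)); apply: allpairs_f.
by apply/asboolP/asboolP; apply: lead_pos_agree sP _ => // b c bs cs; rewrite ag.
Qed.

(** However large [N] is, far enough along the chain [0] there is a block above
    [(t + 1, 0)]. *)
Lemma merged_cone_shifted_neq N : merged_cone t.+1 (shifted N) <> merged_cone t o.
Proof.
have n0 : (0 < n)%N by exact: leq_ltn_trans tn.
(* In the merged order its position [N + 1] is beyond that of [(t + 1, 0)], namely
   [N]. *)
pose b : block n := (Ordinal n0, N.+1%:Z - o (Ordinal n0)).
pose c : block n := (Ordinal tn, 0).
have bc : merged_rel t o b c by rewrite /merged_rel /=; lia.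
have cb : merged_rel t.+1 (shifted N) c b by rewrite /merged_rel /shifted /= eqxx; lia.
pose h : Pgrp n := h_elt c.1 1 c.2 X0 - h_elt b.1 1 b.2 X0.
move=> /(congr1 (fun f => f (of_P p_prime h))); rewrite /merged_cone /lexcone /=.
have -> : `[< lead_pos p pred0 (merged_rel t o) h >].
  by apply/asboolP; exact: lead_pos_diff (merged_rel_order _ _) bc.
move/asboolP/(lead_posN (merged_rel_order _ _)); apply; rewrite opprB.
exact: lead_pos_diff (merged_rel_order _ _) cb.
Qed.

End Shift.

Definition merged_cones k : set {ptws Gn p_prime -> bool} :=
  [set merged_cone t o | t in [set t | (t + k < n)%N] & o in [set: 'I_n -> int]].

Lemma merged_cones_derived k :
  merged_cones k `<=` iter k (@derived _) (space_of_orders (Gn p_prime)).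
Proof.
move: k; apply: sub_iter_derived => [_ [t _ [o _ <-]]|k _ [t tk [o _ <-]]].
  exact: merged_cone_order.
rewrite /= in tk; split; first by exists t => /=; [lia | exists o].
have tn : (t.+1 < n)%N by lia.
exists (fun N => merged_cone t.+1 (shifted t o N)); split; first exact: cvg_shifted.
move=> N; split; last exact: merged_cone_shifted_neq.
by exists t.+1 => /=; [lia | exists (shifted t o N)].
Qed.

End LowerBound.

Theorem theorem5p3 (n : nat) (p : 'I_n -> nat) (hn : (2 <= n)%N)
    (p_prime : forall i : 'I_n, prime (p i)) (p_inj : injective p) :
  CB_rank_is (space_of_orders (Gn p_prime)) (ord_of_nat n).
Proof.
set Y := space_of_orders _; have n0 : (0 < n)%N by exact: ltnW.
have Yn : iter n (@derived _) Y = set0.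
  rewrite -subset0 => P.
  have := @iter_derived_rank _ Y (@nheads n p p_prime).
  move=> /(_ (fun P => @nheads_gt0 _ _ _ P n0) (@nheads_near _ _ _ p_inj) n P) H.
  by move=> /H [_]; rewrite ltnNge nheads_le.
apply/CB_rank_natP; split.
  rewrite iterS Yn; apply/seteqP; split=> // x; by case.
(* Once stationary the derivatives stay constant, but the [m]-th one is nonempty
   and the [n]-th one is empty. *)
move=> m mn E; have Em k : iter (k + m) (@derived _) Y = iter m (@derived _) Y.
  by elim: k => [//|k IH]; rewrite addSn iterS IH -iterS -E.
suff : set0 (merged_cone (p_prime := p_prime) 0 (fun=> 0)) by [].
have := Em (n - m)%N; rewrite subnK ?(ltnW mn) // Yn => ->; apply: merged_cones_derived.
by exists 0%N => //; exists (fun=> 0).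
Qed.
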